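(* (a) Let $B$ and $R$ be sets of $n$ blue and $n$ red points in the plane such that $B\cup R$ is in general position (no three collinear). Then there exists a simple polygon with at most $3\lceil n/2\rceil$ sides that separates $B$ and $R$. (b) For every $n\ge 1$ there exist such sets $B$ and $R$ that cannot be separated by any simple polygon with fewer than $n$ sides.
   Context: A simple polygon (whose vertices may be arbitrary points of the plane) separates $B$ and $R$ if one of the two sets lies entirely in the interior of the polygon and the other lies entirely in its exterior. *)

(* Defs.v *)
From mathcomp Require Export all_boot all_order all_algebra.
From mathcomp Require Export all_classical all_reals all_analysis.
Export numFieldNormedType.Exports.

Set Implicit Arguments.
Unset Strict Implicit.
Unset Printing Implicit Defensive.

Import Order.TTheory GRing.Theory Num.Theory.

Local Open Scope classical_set_scope.
Local Open Scope ring_scope.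

Section Plane.
Variable K : realType.
Implicit Types (p q r : K * K) (X B R : set (K * K)).

Definition collinear p q r : Prop :=
  exists a b c : K, (a, b) != (0, 0) /\
    [/\ a * p.1 + b * p.2 = c, a * q.1 + b * q.2 = c & a * r.1 + b * r.2 = c].

Definition general_position X : Prop :=
  forall p q r, X p -> X q -> X r ->
    p != q -> q != r -> p != r -> ~ collinear p q r.

Definition bichromatic (n : nat) B R : Prop :=
  [/\ (B #= `I_n)%card, (R #= `I_n)%card, B `&` R = set0 & general_position (B `|` R)].

Definition segment p q : set (K * K) :=
  [set (1 - t) *: p + t *: q | t in `[0, 1]].

(* A polygon with k sides is given by its vertices P 0, ..., P (k - 1) in
   cyclic order; side i joins P i to P (i + 1 mod k). *)
Definition side (k : nat) (P : 'I_k -> K * K) (i : 'I_k) : set (K * K) :=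
  segment (P i) (P (ordS i)).

(* Injectivity is not redundant: for k = 3 the constant P satisfies the other
   conditions. *)
Definition simple_polygon (k : nat) (P : 'I_k -> K * K) : Prop :=
  [/\ (3 <= k)%N,
      injective P,
      forall i, side P i `&` side P (ordS i) = [set P (ordS i)]
    & forall i j, i != j -> j != ordS i -> i != ordS j ->
        side P i `&` side P j = set0].

Definition polygon_boundary (k : nat) (P : 'I_k -> K * K) : set (K * K) :=
  \bigcup_i side P i.

(* The interior and the exterior are the union of the bounded, resp. unbounded,
   connected components of the complement of the boundary; for a simple polygon
   there is one of each by the Jordan curve theorem. *)
Definition polygon_interior (k : nat) (P : 'I_k -> K * K) : set (K * K) :=
  [set x | ~ polygon_boundary P x /\
           bounded_set (connected_component (~` polygon_boundary P) x)].

Definition polygon_exterior (k : nat) (P : 'I_k -> K * K) : set (K * K) :=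
  [set x | ~ polygon_boundary P x /\
           ~ bounded_set (connected_component (~` polygon_boundary P) x)].

Definition separates (k : nat) (P : 'I_k -> K * K) B R : Prop :=
  (B `<=` polygon_interior P /\ R `<=` polygon_exterior P) \/
  (R `<=` polygon_interior P /\ B `<=` polygon_exterior P).

End Plane.

(* Main.v *)
Require Import Defs.
From mathcomp Require Import ring lra zify.
Set Implicit Arguments.
Unset Strict Implicit.
Unset Printing Implicit Defensive.
Import Order.TTheory GRing.Theory Num.Theory.
Local Open Scope classical_set_scope.
Local Open Scope ring_scope.

(* Upper bound.  After adding a generic point if n is odd, an even number of
   blue points must be enclosed.  A slightly rotated edge of their convex hull
   gives an affine function h and a thin red-free slab containing exactly two
   blue points, with all the others above it; a very long thin triangle in the
   slab is the initial polygon.  The remaining blue points are sorted by h and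
   consecutive ones are paired.  For a pair b, b' with h b < h b', a thin spike
   with apex just beyond b' is driven through b' and b downwards until it first
   hits the current polygon, and is merged with it at the cost of three sides.
   Below b there are only blue points already enclosed, the spike must hit the
   polygon since the triangle is long, and it avoids the red points because
   none of them lies on the line b b'.

   Lower bound.  Colour 2n points of a parabola alternately.  Each of the
   2n - 1 segments between consecutive points meets the boundary of a
   separating polygon, and a side avoiding the points meets at most two of
   them. *)

(** The Jordan curve theorem is never invoked. Each polygon is built together with a closed bounded
    region [C] whose interior is open and accumulates at every boundary point, and whose complement
    is connected. These properties already put the interior into bounded components and the
    complement of [C] into an unbounded one, and attaching a spike preserves them. Sorting by [h]
    serves to keep the current region strictly below both points of the next pair, so that the spike
    from its apex down to [b] runs outside the region. Each line [b b'] crosses the level [h = 0] at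
    a point that the initial triangle has to enclose; there are finitely many such points, and they
    dictate its length. Since interiors only grow, the crossing is still enclosed when its pair is
    treated, and it serves as the place where the spike is bound to have entered the region. Three
    sides for the first two points and three for each further pair give [3 * j.+1] sides for
    [j.+1.*2] points. For the lower bound, [k] sides meeting at most two of the [2n - 1] segments
    each gives [2n - 1 <= 2k], hence [n <= k]. *)

Section Plane.
Variable K : realType.
Implicit Types (p q r x y : K * K) (A B C U V : set (K * K)) (t : K) (f g : K * K -> K).

(** * Affine functions, segments, convexity and connectedness in the plane *)

Definition affine (f : K * K -> K) :=
  exists a b c, forall x, f x = a * x.1 + b * x.2 + c.

Lemma affine_continuous f : affine f -> continuous f.
Proof.
move=> [a [b [c fE]]].
have -> : f = (fun x => a * x.1 + b * x.2 + c) by apply: funext.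
move=> x; apply: cvgD; last exact: cvg_cst.
by apply: cvgD; apply: cvgM; [exact: cvg_cst | exact: cvg_fst
  | exact: cvg_cst | exact: cvg_snd].
Qed.

Lemma affine_cst c : affine (fun=> c).
Proof. by exists 0, 0, c => x; ring. Qed.

Lemma affineD f g : affine f -> affine g -> affine (fun x => f x + g x).
Proof.
move=> [a [b [c fE]]] [a' [b' [c' gE]]].
by exists (a + a'), (b + b'), (c + c') => x; rewrite fE gE; ring.
Qed.

Lemma affineN f : affine f -> affine (fun x => - f x).
Proof.
by move=> [a [b [c fE]]]; exists (- a), (- b), (- c) => x; rewrite fE; ring.
Qed.

Lemma affineB f g : affine f -> affine g -> affine (fun x => f x - g x).
Proof. by move=> ff fg; apply: affineD => //; apply: affineN. Qed.

Lemma open_affine_lt f g : affine f -> affine g -> open [set x | f x < g x].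
Proof.
move=> ff fg.
have -> : [set x | f x < g x] = (fun x => g x - f x) @^-1` [set t | 0 < t].
  by apply/seteqP; split=> x /=; rewrite subr_gt0.
apply: open_comp; last exact: open_gt.
by move=> x _; apply: affine_continuous; apply: affineB.
Qed.

Lemma closed_affine_le f g : affine f -> affine g -> closed [set x | f x <= g x].
Proof.
move=> ff fg.
have -> : [set x | f x <= g x] = ~` [set x | g x < f x].
  by apply/seteqP; split=> x /=; rewrite leNgt => /negP.
by apply: open_closedC; apply: open_affine_lt.
Qed.

Lemma segmentP p q x :
  segment p q x <-> exists2 t : K, 0 <= t <= 1 &
    x = (p.1 + t * (q.1 - p.1), p.2 + t * (q.2 - p.2)).
Proof.
have E t : (1 - t) *: p + t *: q =
    (p.1 + t * (q.1 - p.1), p.2 + t * (q.2 - p.2)).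
  case: p q => [p1 p2] [q1 q2]; rewrite /=.
  by congr pair => /=; rewrite /GRing.scale /=; ring.
split=> [[t /=]|[t t01 ->]].
  by rewrite in_itv /= => t01 <-; exists t.
by exists t; rewrite /= ?in_itv /= ?E.
Qed.

Lemma segmentl p q : segment p q p.
Proof. by apply/segmentP; exists 0; rewrite ?lexx ?ler01 //; case: p => a b /=; congr pair; ring. Qed.

Lemma segmentr p q : segment p q q.
Proof. by apply/segmentP; exists 1; rewrite ?lexx ?ler01 //; case: q => a b /=; congr pair; ring. Qed.

Lemma segmentC p q : segment p q = segment q p.
Proof.
have S (a b : K * K) : segment a b `<=` segment b a.
  move=> x /segmentP[t t01 ->]; apply/segmentP; exists (1 - t); first by lra.
  by congr pair; ring.
by apply/seteqP; split; apply: S.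
Qed.

Lemma affine_segment f p q t : affine f ->
  f (p.1 + t * (q.1 - p.1), p.2 + t * (q.2 - p.2)) = f p + t * (f q - f p).
Proof. by move=> [a [b [c fE]]]; rewrite !fE /=; ring. Qed.

Lemma segment_connected2 p q : connected (segment p q).
Proof.
rewrite /segment; apply: connected_continuous_connected.
  exact: segment_connected.
apply: continuous_subspaceT => t.
apply: cvgD; apply: cvgZr_tmp; last exact: cvg_id.
by apply: cvgB; [exact: cvg_cst | exact: cvg_id].
Qed.

Definition convex_set A := forall x y, A x -> A y -> segment x y `<=` A.

Lemma convex_connected A : convex_set A -> connected A.
Proof.
move=> cA; have [[a Aa]|/nonemptyPn ->] := pselect (A !=set0); last exact: connected0.
have -> : A = \bigcup_(y in A) segment a y.
  apply/seteqP; split=> [y Ay|y [z Az]]; last exact: cA.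
  by exists y => //; apply: segmentr.
apply: bigcup_connected => [|y _]; last exact: segment_connected2.
by exists a => y _; apply: segmentl.
Qed.

Lemma convex_affine_lt f g : affine f -> affine g -> convex_set [set x | f x < g x].
Proof.
move=> ff fg x y /= xl yl _ /segmentP[t t01 ->] /=.
rewrite !affine_segment //; case/andP: t01 => t0 t1.
have [->|t0'] := eqVneq t 0; first by lra.
have : 0 < t by rewrite lt_def t0' t0.
by nra.
Qed.

Lemma convex_affine_le f g : affine f -> affine g -> convex_set [set x | f x <= g x].
Proof.
move=> ff fg x y /= xl yl _ /segmentP[t t01 ->] /=.
by rewrite !affine_segment //; case/andP: t01 => t0 t1; nra.
Qed.

Lemma convexI A B : convex_set A -> convex_set B -> convex_set (A `&` B).
Proof. by move=> cA cB x y [Ax Bx] [Ay By] z zs; split; [apply: (cA x y)|apply: (cB x y)]. Qed.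

(** Connectedness in terms of ambient open sets, because the regions below are given as open or
    closed subsets of the plane rather than as relatively clopen ones. *)
Lemma connected_openP A : connected A <-> forall U V, open U -> open V ->
  A `<=` U `|` V -> (forall x, A x -> U x -> V x -> False) ->
  A `&` U !=set0 -> A `&` V !=set0 -> False.
Proof.
split=> [cA U V oU oV AUV dUV AU [x xAV] | H D D0 [G oG DG] [F cF DF]].
  case: xAV => Ax Vx.
  have : A `&` U = A.
    apply: cA => //; first by exists U.
    exists (~` V); first exact: open_closedC.
    apply/seteqP; split=> y [Ay]; first by move=> Uy; split => // Vy; apply: dUV Vy.
    by move=> nV; split => //; case: (AUV y Ay).
  by move=> /seteqP[_ /(_ x Ax)[_ Ux]]; apply: dUV Vx.
apply/seteqP; split; first by rewrite DG => x [].
move=> x Ax; apply: contrapT => nDx.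
apply: (H G (~` F)) => //.
- exact: closed_openC.
- move=> y Ay; have [Fy|] := pselect (F y); last by right.
  left; have : D y by rewrite DF.
  by rewrite DG => -[].
- move=> y Ay Gy; apply.
  have : D y by rewrite DG.
  by rewrite DF => -[].
- by rewrite -DG.
- by exists x; split => // Fx; apply: nDx; rewrite DF.
Qed.

(** With [U] and [V] the interior and the complement of a polygonal region, in either order, this
    traps a connected set that misses the boundary on one side of it. *)
Lemma connected_sub_open A U V : connected A -> open U -> open V ->
  A `<=` U `|` V -> (forall x, A x -> U x -> V x -> False) ->
  A `&` U !=set0 -> A `<=` U.
Proof.
move=> /connected_openP cA oU oV AUV dUV AU x Ax; apply: contrapT => nU.
by apply: (cA U V) => //; exists x; split => //; case: (AUV x Ax).
Qed.

Lemma bounded_setP A : bounded_set A <->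
  exists M, forall x, A x -> `|x.1| <= M /\ `|x.2| <= M.
Proof.
split=> [[M [Mr H]] | [M H]].
  exists (M + 1) => x Ax; have := H (M + 1); rewrite ltrDl ltr01 => /(_ isT _ Ax).
  by move=> HH; have : `|x| <= M + 1 := HH; rewrite prod_normE /= ge_max => /andP[].
exists M; split; first exact: num_real.
move=> N MN x Ax; have [h1 h2] := H x Ax.
suff : `|x| <= N by [].
by rewrite prod_normE /= ge_max; apply/andP; split; lra.
Qed.

Lemma bounded_setU2 A B : bounded_set A -> bounded_set B -> bounded_set (A `|` B).
Proof.
move=> /bounded_setP[M HM] /bounded_setP[N HN]; apply/bounded_setP.
exists (Num.max M N) => x [/HM|/HN] [h1 h2]; rewrite !le_max h1 h2 ?orbT //.
Qed.

Lemma not_bounded_setT : ~ bounded_set (@setT (K * K)).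
Proof.
move=> /bounded_setP[M /(_ (M + 1, 0) I)[/=]].
have := ler_norm (M + 1); lra.
Qed.

(** The parameter [t = 0] is left out: [x] is meant to be a boundary point, approached by points of
    [W] on the way from [m]. *)
Lemma closure_convexcomb W x m : (forall t, 0 < t <= 1 ->
  W (x.1 + t * (m.1 - x.1), x.2 + t * (m.2 - x.2))) -> closure W x.
Proof.
move=> Wt O xO; pose g t := (x.1 + t * (m.1 - x.1), x.2 + t * (m.2 - x.2)).
have g0 : g 0 = x by rewrite /g !mul0r !addr0; case: x {Wt xO g}.
have gc : {for 0, continuous g}.
  by apply: (@cvg_pair _ _ _ _ (nbhs (g 0).1) (nbhs (g 0).2)); apply: cvgD; try exact: cvg_cst; apply: cvgM; [exact: cvg_id|exact: cvg_cst|exact: cvg_id|exact: cvg_cst].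
have : \forall t \near (0 : K), O (g t) by apply: gc; rewrite g0.
move=> /nbhs_ballP[e /= e0 He].
have [m0 m1] : 0 < Num.min 1 (e / 2) /\ Num.min 1 (e / 2) < e.
  by split; [rewrite lt_min ltr01 /=|rewrite gt_min; apply/orP; right]; lra.
exists (g (Num.min 1 (e / 2))); split; first by apply: Wt; rewrite m0 ge_min lexx.
by apply: He; rewrite /ball /= sub0r normrN gtr0_norm.
Qed.

End Plane.

(** * Polygons, and the replacement of the middle of a side by a detour through a new vertex *)

Section Polygon.
Variable K : realType.
Implicit Types (p : nat -> K * K) (x y q w : K * K) (s t : K).

Definition nside p i := segment (p i) (p i.+1).

Definition nboundary k p : set (K * K) := [set x | exists2 i, (i < k)%N & nside p i x].

(* Polygons are indexed by [nat] with the convention [p k = p 0], so that side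
   [k - 1] needs no reduction modulo [k]. *)
Definition nsimple k p := [/\ (3 <= k)%N, p k = p 0%N,
  forall i j, (i < j < k)%N -> p i <> p j &
  forall i j x, (i < j < k)%N -> nside p i x -> nside p j x ->
    (j = i.+1 /\ x = p j) \/ [/\ i = 0%N, j.+1 = k & x = p 0%N]].

(** Side [i] becomes the path [p i], [w1], [q], [w2], [p i.+1]: four sides instead of one, which is
    why a spike costs three. *)
Definition insert3 p i w1 q w2 j :=
  if (j <= i)%N then p j else if j == i.+1 then w1 else
  if j == i.+2 then q else if j == i.+3 then w2 else p (j - 3)%N.

Definition nalong p i s : K * K :=
  ((p i).1 + s * ((p i.+1).1 - (p i).1), (p i).2 + s * ((p i.+1).2 - (p i).2)).

Section Insert.
Variables (k : nat) (p : nat -> K * K) (i0 : nat) (w1 q w2 : K * K) (s1 s2 : K).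
Hypotheses (sp : nsimple k p) (i0k : (i0 < k)%N).
Hypotheses (s1_gt0 : 0 < s1) (s12 : s1 < s2) (s2_lt1 : s2 < 1).
Local Notation along := (nalong p i0).
Hypotheses (w1E : w1 = along s1) (w2E : w2 = along s2).
Hypothesis qNbnd : ~ nboundary k p q.
Hypothesis w1q_bnd : forall x, segment w1 q x -> nboundary k p x -> x = w1.
Hypothesis qw2_bnd : forall x, segment q w2 x -> nboundary k p x -> x = w2.
Hypothesis w1q_qw2 : forall x, segment w1 q x -> segment q w2 x -> x = q.

Local Notation p' := (insert3 p i0 w1 q w2).

Let side_neq : p i0 <> p i0.+1.
Proof.
have [k3 pk inj _] := sp; have [e|ik] := eqVneq i0.+1 k.
  by rewrite e pk => /esym; apply: inj; lia.
by apply: inj; lia.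
Qed.

Let along_inj s t : along s = along t -> s = t.
Proof.
move=> [e1 e2]; apply: contrapT => st; apply: side_neq.
have st' : s - t != 0 by rewrite subr_eq0; apply/eqP.
rewrite [p i0]surjective_pairing [p i0.+1]surjective_pairing.
by congr pair; apply/eqP; rewrite eq_sym -subr_eq0; apply/eqP; apply: (mulfI st'); lra.
Qed.

Let along0 : along 0 = p i0.
Proof. by rewrite /nalong !mul0r !addr0; case: (p i0). Qed.

Let along1 : along 1 = p i0.+1.
Proof. by rewrite /nalong; case: (p i0.+1) => a b /=; congr pair; ring. Qed.

Let sideP x : nside p i0 x <-> exists2 s : K, 0 <= s <= 1 & x = along s.
Proof. exact: segmentP. Qed.

Let alongA x : segment (p i0) w1 x <-> exists2 s : K, 0 <= s <= s1 & x = along s.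
Proof.
move: (s1_gt0) (s12) (s2_lt1) => hs1 hs12 hs2.
split=> [/segmentP[t t01 ->]|[s ss ->]].
  case/andP: t01 => t0 t1.
  exists (t * s1); first by rewrite mulr_ge0 ?(ltW s1_gt0) //= ler_piMl // ltW.
  by rewrite w1E /nalong /=; congr pair; ring.
apply/segmentP; exists (s / s1); first by rewrite divr_ge0 ?ler_pdivrMr //=; lra.
by rewrite w1E /nalong /=; congr pair; field; apply: lt0r_neq0.
Qed.

Let alongD x : segment w2 (p i0.+1) x <-> exists2 s : K, s2 <= s <= 1 & x = along s.
Proof.
move: (s1_gt0) (s12) (s2_lt1) => hs1 hs12 hs2.
split=> [/segmentP[t t01 ->]|[s ss ->]].
  case/andP: t01 => t0 t1.
  have t2 : 0 <= t * (1 - s2) by apply: mulr_ge0 => //; lra.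
  have t3 : 0 <= (1 - t) * (1 - s2) by apply: mulr_ge0 => //; lra.
  exists (s2 + t * (1 - s2)); first by lra.
  by rewrite w2E /nalong /=; congr pair; ring.
apply/segmentP; exists ((s - s2) / (1 - s2)).
  by apply/andP; split; [apply: divr_ge0; lra|rewrite ler_pdivrMr; lra].
have h : 1 - s2 != 0 by apply: lt0r_neq0; lra.
by rewrite w2E /nalong /=; congr pair; field.
Qed.

(** By [nsimple], a point common to side [i0] and another side is an end point of side [i0], and
    [along s] is neither of the two. *)
Let along_other s m : 0 < s < 1 -> (m < k)%N -> nside p m (along s) -> m = i0.
Proof.
move: (s1_gt0) (s12) (s2_lt1) => hs1 hs12 hs2.
move=> s01 mk ms; have [_ _ _ sim] := sp.
have is_ : nside p i0 (along s) by apply/sideP; exists s => //; lra.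
apply: contrapT => mi.
have n0 : along s <> p i0 by rewrite -along0 => /along_inj; lra.
have n1 : along s <> p i0.+1 by rewrite -along1 => /along_inj; lra.
have [mlt|mgt] : (m < i0)%N \/ (i0 < m)%N by lia.
  have [[] //|[m0 ik e]] := sim m i0 _ ltac:(lia) ms is_.
  by apply: n1; rewrite ik; have [_ -> _ _] := sp.
have [[e e']|[i00 ik e]] := sim i0 m _ ltac:(lia) is_ ms.
  by apply: n1; rewrite -e.
by apply: n0; rewrite e i00.
Qed.

Let w1_bnd : nboundary k p w1.
Proof.
move: (s1_gt0) (s12) (s2_lt1) => hs1 hs12 hs2.
by exists i0 => //; apply/sideP; exists s1 => //; lra. Qed.

Let w2_bnd : nboundary k p w2.
Proof.
move: (s1_gt0) (s12) (s2_lt1) => hs1 hs12 hs2.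
by exists i0 => //; apply/sideP; exists s2 => //; lra. Qed.

Let vertex_bnd j : (j <= k)%N -> nboundary k p (p j).
Proof.
have [k3 pk _ _] := sp; rewrite leq_eqVlt => /orP[/eqP ->|jk]; last first.
  by exists j => //; apply: segmentl.
by exists 0%N; [lia|rewrite pk; apply: segmentl].
Qed.

Let vertex_neq s j : 0 < s < 1 -> (j <= k)%N -> along s <> p j.
Proof.
move=> s01; have [k3 pk _ _] := sp.
have H m : (m < k)%N -> along s <> p m.
  move=> mk e; have : nside p m (along s) by rewrite e; apply: segmentl.
  move/(along_other s01 mk) => mi; move: e; rewrite mi -along0 => /along_inj; lra.
by rewrite leq_eqVlt => /orP[/eqP ->|/H //]; rewrite pk; apply: H; lia.
Qed.

Let pL j : (j <= i0)%N -> p' j = p j.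
Proof. by rewrite /insert3 => ->. Qed.
Let p1 : p' i0.+1 = w1.
Proof. by rewrite /insert3 ltnn eqxx. Qed.
Let p2 : p' i0.+2 = q.
Proof. by rewrite /insert3 eqxx; case: ifP => ?; [lia|case: ifP => ?; [lia|]]. Qed.
Let p3 : p' i0.+3 = w2.
Proof.
rewrite /insert3 eqxx; case: ifP => ?; [lia|case: ifP => ?; [lia|]].
by case: ifP => ?; [lia|].
Qed.
Let pR j : (i0.+3 < j)%N -> p' j = p (j - 3)%N.
Proof.
by move=> ij; rewrite /insert3; do 4 (case: ifP => ?; [lia|]).
Qed.

Let insert_side j x : (j < k + 3)%N -> nside p' j x ->
  (j < i0)%N /\ nside p j x \/ j = i0 /\ segment (p i0) w1 x \/
  j = i0.+1 /\ segment w1 q x \/ j = i0.+2 /\ segment q w2 x \/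
  j = i0.+3 /\ segment w2 (p i0.+1) x \/ (i0.+3 < j)%N /\ nside p (j - 3)%N x.
Proof.
move=> jk; rewrite /nside.
have [->|n0] := eqVneq j i0; first by rewrite pL // p1 => ?; right; left.
have [->|n1] := eqVneq j i0.+1; first by rewrite p1 p2 => ?; right; right; left.
have [->|n2] := eqVneq j i0.+2; first by rewrite p2 p3 => ?; do 3 right; left.
have [->|n3] := eqVneq j i0.+3.
  rewrite p3 pR // (_ : (i0.+4 - 3)%N = i0.+1); last by lia.
  by move=> ?; do 4 right; left.
have [h1|h1] := leqP j i0.
  by rewrite !pL //; [move=> ?; left; split => //; lia|lia].
rewrite !pR; try lia; rewrite (_ : (j.+1 - 3)%N = (j - 3).+1); last by lia.
by move=> ?; do 5 right; split => //; lia.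
Qed.

Lemma insert3_boundary x : nboundary (k + 3) p' x <->
  (exists2 i, (i < k)%N /\ i <> i0 & nside p i x) \/ segment (p i0) w1 x \/
  segment w2 (p i0.+1) x \/ segment w1 q x \/ segment q w2 x.
Proof.
split=> [[j jk]|].
  move/(insert_side jk) => [[h1 h2]|[[_ h2]|[[_ h2]|[[_ h2]|[[_ h2]|[h1 h2]]]]]].
  - by left; exists j => //; lia.
  - by right; left.
  - by right; right; right; left.
  - by right; right; right; right.
  - by right; right; left.
  - by left; exists (j - 3)%N => //; lia.
case=> [[i [ik ii0] h]|[h|[h|[h|h]]]].
- have [ilt|igt] : (i < i0)%N \/ (i0 < i)%N by lia.
    by exists i; [lia|rewrite /nside !pL //; lia].
  exists (i + 3)%N; first by lia.
  by rewrite /nside !pR; try lia; rewrite -addSn !addnK.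
- by exists i0; [lia|rewrite /nside p1 pL].
- exists i0.+3; first by lia.
  by rewrite /nside p3 pR // (_ : (i0.+4 - 3)%N = i0.+1) //; lia.
- by exists i0.+1; [lia|rewrite /nside p1 p2].
- by exists i0.+2; [lia|rewrite /nside p2 p3].
Qed.

(** The two remaining pieces of side [i0] are parts of it, so their contacts with old sides come
    from the simplicity of [p]. The two new edges touch the old boundary only at [w1] and [w2],
    which lie strictly inside side [i0] and hence on no other old side. *)
Lemma insert3_simple : nsimple (k + 3) p'.
Proof.
move: (s1_gt0) (s12) (s2_lt1) => hs1 hs12 hs2.
have [k3 pk inj sim] := sp.
have s1' : 0 < s1 < 1 by lra.
have s2' : 0 < s2 < 1 by lra.
have qV j : (j <= k)%N -> p j <> q by move=> jk e; apply: qNbnd; rewrite -e; apply: vertex_bnd.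
have w1V j : (j <= k)%N -> p j <> w1 by move=> jk; rewrite w1E => /esym; apply: vertex_neq.
have w2V j : (j <= k)%N -> p j <> w2 by move=> jk; rewrite w2E => /esym; apply: vertex_neq.
have w12 : w1 <> w2 by rewrite w1E w2E => /along_inj; lra.
have qw1 : q <> w1 by move=> e; apply: qNbnd; rewrite e.
have qw2 : q <> w2 by move=> e; apply: qNbnd; rewrite e.
split; first by lia.
- rewrite pR; last by lia.
  by rewrite addnK pL.
- move=> i j ij.
  have H n : (n < k + 3)%N -> (n <= i0)%N \/ n = i0.+1 \/ n = i0.+2 \/ n = i0.+3 \/ (i0.+3 < n)%N.
    move=> nk; have [?|?] := leqP n i0; first by left.
    have [?|?] := eqVneq n i0.+1; first by right; left.
    have [?|?] := eqVneq n i0.+2; first by right; right; left.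
    have [?|?] := eqVneq n i0.+3; first by right; right; right; left.
    by right; right; right; right; lia.
  have [hi|[hi|[hi|[hi|hi]]]] := H i ltac:(lia);
  have [hj|[hj|[hj|[hj|hj]]]] := H j ltac:(lia); try (exfalso; lia);
  first [rewrite (pL hi)|rewrite (pR hi)|rewrite hi ?p1 ?p2 ?p3];
  first [rewrite (pL hj)|rewrite (pR hj)|rewrite hj ?p1 ?p2 ?p3];
  try (apply: inj; lia).
  + by apply: w1V; lia.
  + by apply: qV; lia.
  + by apply: w2V; lia.
  + by move=> /esym.
  + by [].
  + by move=> /esym; apply: w1V; lia.
  + by [].
  + by move=> /esym; apply: qV; lia.
  + by move=> /esym; apply: w2V; lia.
have A_side x : segment (p i0) w1 x -> nside p i0 x.
  by move=> /alongA[s ss ->]; apply/sideP; exists s => //; lra.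
have D_side x : segment w2 (p i0.+1) x -> nside p i0 x.
  by move=> /alongD[s ss ->]; apply/sideP; exists s => //; lra.
have A_D x : segment (p i0) w1 x -> segment w2 (p i0.+1) x -> False.
  by move=> /alongA[s ss ->] /alongD[t tt /along_inj]; lra.
have w2A : ~ segment (p i0) w1 w2 by rewrite w2E => /alongA[s ss /along_inj]; lra.
have w1D : ~ segment w2 (p i0.+1) w1 by rewrite w1E => /alongD[s ss /along_inj]; lra.
(* Each piece misses the far end of side [i0]; this excludes contacts at a vertex that now belongs
   to the other piece only. *)
have A_end : ~ segment (p i0) w1 (p i0.+1).
  by rewrite -along1 => /alongA[s ss /along_inj]; lra.
have D_end : ~ segment w2 (p i0.+1) (p i0).
  by rewrite -along0 => /alongD[s ss /along_inj]; lra.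
have oldB m x : (m < k)%N -> m <> i0 -> nside p m x -> segment w1 q x -> False.
  move=> mk mi xm xB; apply: mi; have e : x = w1 by apply: w1q_bnd => //; exists m.
  by apply: (along_other s1') => //; rewrite -w1E -e.
have oldC m x : (m < k)%N -> m <> i0 -> nside p m x -> segment q w2 x -> False.
  move=> mk mi xm xB; apply: mi; have e : x = w2 by apply: qw2_bnd => //; exists m.
  by apply: (along_other s2') => //; rewrite -w2E -e.
move=> i j x ij xi xj.
have [ik jk] : (i < k + 3 /\ j < k + 3)%N by lia.
have [[hi {}xi]|[[hi {}xi]|[[hi {}xi]|[[hi {}xi]|[[hi {}xi]|[hi {}xi]]]]]] := insert_side ik xi;
have [[hj {}xj]|[[hj {}xj]|[[hj {}xj]|[[hj {}xj]|[[hj {}xj]|[hj {}xj]]]]]] := insert_side jk xj;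
  try (exfalso; lia).
- have [[e1 e2]|[e1 e2 e3]] := sim i j x ltac:(lia) xi xj; last by lia.
  by left; split => //; rewrite pL //; lia.
- have [[e1 e2]|[e1 e2 e3]] := sim i i0 x ltac:(lia) xi (A_side _ xj).
    by left; split; [lia|rewrite hj pL].
  by exfalso; apply: A_end; rewrite e2 pk -e3.
- by exfalso; apply: (oldB i x) => //; lia.
- by exfalso; apply: (oldC i x) => //; lia.
- have [[e1 e2]|[e1 e2 e3]] := sim i i0 x ltac:(lia) xi (D_side _ xj).
    by exfalso; apply: D_end; rewrite -e2.
  by right; split; [lia|lia|rewrite pL].
- have [[e1 e2]|[e1 e2 e3]] := sim i (j - 3)%N x ltac:(lia) xi xj; first by lia.
  by right; split; [lia|lia|rewrite pL].
- left; split; first by lia.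
  rewrite hj p1; apply: w1q_bnd => //; exists i0 => //; exact: A_side.
- exfalso; apply: w2A; have <- // : x = w2.
  by apply: qw2_bnd => //; exists i0 => //; exact: A_side.
- by exfalso; apply: (A_D x).
- have [[e1 e2]|[e1 e2 e3]] := sim i0 (j - 3)%N x ltac:(lia) (A_side _ xi) xj.
    by exfalso; apply: A_end; rewrite -e1 -e2.
  by right; split; [lia|lia|rewrite pL].
- by left; split; [lia|rewrite hj p2; apply: w1q_qw2].
- exfalso; apply: w1D; have <- // : x = w1.
  by apply: w1q_bnd => //; exists i0 => //; exact: D_side.
- by exfalso; apply: (oldB (j - 3)%N x) => //; lia.
- left; split; first by lia.
  rewrite hj p3; apply: qw2_bnd => //; exists i0 => //; exact: D_side.
- by exfalso; apply: (oldC (j - 3)%N x) => //; lia.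
- have [[e1 e2]|[e1 e2 e3]] := sim i0 (j - 3)%N x ltac:(lia) (D_side _ xi) xj.
    by left; split; [lia|rewrite pR].
  by exfalso; apply: D_end; have <- : x = p i0 by rewrite e1.
- have [[e1 e2]|[e1 e2 e3]] := sim (i - 3)%N (j - 3)%N x ltac:(lia) xi xj; last by lia.
  by left; split; [lia|rewrite pR].
Qed.

Lemma insert3_boundary_old x :
  nboundary k p x -> (forall s, s1 < s < s2 -> x <> along s) -> nboundary (k + 3) p' x.
Proof.
move: (s1_gt0) (s12) (s2_lt1) => hs1 hs12 hs2.
move=> [i ik xi] xn; apply/insert3_boundary.
have [ii|/eqP ii] := eqVneq i i0; last by left; exists i.
move: xi; rewrite ii => /sideP[s s01 xE].
have [h|h] := leP s s1; first by right; left; apply/alongA; exists s => //; lra.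
have [h'|h'] := leP s2 s; first by right; right; left; apply/alongD; exists s => //; lra.
by exfalso; apply: (xn s); rewrite ?h.
Qed.

Lemma insert3_boundary_new x : nboundary (k + 3) p' x ->
  [\/ nboundary k p x /\ (forall s, s1 < s < s2 -> x <> along s),
      segment w1 q x | segment q w2 x].
Proof.
move: (s1_gt0) (s12) (s2_lt1) => hs1 hs12 hs2.
move=> /insert3_boundary[[i [ik ii0] h]|[h|[h|[h|h]]]]; last 2 first.
- by constructor 2.
- by constructor 3.
- constructor 1; split; first by exists i.
  by move=> s ss e; apply: ii0; apply: (@along_other s) => //; [lra|rewrite -e].
- constructor 1; move: h => /alongA[s ss ->]; split.
    by exists i0 => //; apply/sideP; exists s => //; lra.
  by move=> t tt /along_inj; lra.
- constructor 1; move: h => /alongD[s ss ->]; split.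
    by exists i0 => //; apply/sideP; exists s => //; lra.
  by move=> t tt /along_inj; lra.
Qed.

End Insert.
End Polygon.

(** * Regions bounded by polygons, and the gluing of a triangular spike *)

Section Attach.
Variable K : realType.
Implicit Types (p : nat -> K * K) (x y q w o u v : K * K) (s t : K)
  (C T V O U : set (K * K)) (l m : K * K -> K) (g : K -> K -> K * K).

(* Affine coordinates [l], [m] of the plane; [g] is the inverse map. *)
Definition frame l m g := [/\ affine l, affine m,
  forall a b, l (g a b) = a /\ m (g a b) = b, forall x, g (l x) (m x) = x &
  exists o u v, forall a b,
    g a b = (o.1 + a * u.1 + b * v.1, o.2 + a * u.2 + b * v.2)].

Lemma frameC l m g : frame l m g -> frame m l (fun a b => g b a).
Proof.
move=> [al am glm gK [z [u [v gE]]]]; split=> //; first by move=> a b; case: (glm b a).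
by exists z, v, u => a b; rewrite gE; congr pair; ring.
Qed.

(** Normalises a chord: the segment from [g s 0] to [g 0 t] becomes the unit chord [l x + m x = 1]
    of the new frame. *)
Lemma frame_rescale l m g s t : s != 0 -> t != 0 -> frame l m g ->
  frame (fun x => l x / s) (fun x => m x / t) (fun a b => g (s * a) (t * b)).
Proof.
move=> s0 t0 [[la [lb [lc lE]]] [ma [mb [mc mE]]] glm gK [z [u [v gE]]]]; split.
- by exists (la / s), (lb / s), (lc / s) => x; rewrite lE; field.
- by exists (ma / t), (mb / t), (mc / t) => x; rewrite mE; field.
- by move=> a b; have [-> ->] := glm (s * a) (t * b); split; field.
- move=> x; rewrite -[RHS]gK; congr g; by field.
- exists z, (s * u.1, s * u.2), (t * v.1, t * v.2) => a b.
  by rewrite gE /=; congr pair; ring.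
Qed.

Lemma frame_inj l m g x y : frame l m g -> l x = l y -> m x = m y -> x = y.
Proof. by move=> [_ _ _ gK _] e1 e2; rewrite -(gK x) -(gK y) e1 e2. Qed.

Lemma frame_segment l m g x y z : frame l m g ->
  segment x y z <-> exists2 t : K, 0 <= t <= 1 &
    l z = l x + t * (l y - l x) /\ m z = m x + t * (m y - m x).
Proof.
move=> fr; have [al am _ _ _] := fr; split=> [/segmentP[t t01 ->]|[t t01 [lz mz]]].
  by exists t => //; rewrite !affine_segment.
by apply/segmentP; exists t => //; apply: (frame_inj fr); rewrite affine_segment.
Qed.

Lemma frame_triangle_bounded l m g : frame l m g ->
  bounded_set [set x | [/\ 0 <= l x, 0 <= m x & l x + m x <= 1]].
Proof.
move=> [al am glm gK [z [u [v gE]]]]; apply/bounded_setP.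
exists (Num.max (`|z.1| + `|u.1| + `|v.1|) (`|z.2| + `|u.2| + `|v.2|)).
move=> x /= [l0 m0 lm]; rewrite !le_max -(gK x) gE /=.
have B (c d e : K) : `|c + l x * d + m x * e| <= `|c| + `|d| + `|e|.
  rewrite (le_trans (ler_normD _ _)) // lerD //.
    rewrite (le_trans (ler_normD _ _)) // lerD // normrM ger0_norm // ler_piMl //; lra.
  by rewrite normrM ger0_norm // ler_piMl //; lra.
by split; apply/orP; [left|right]; apply: B.
Qed.

(* A component of [V `\` T] missing the collar [O `\` T] would be clopen in
   [V]. *)
Lemma connected_setD V T O : open V -> connected V -> closed T -> open O ->
  O `<=` V -> V `&` T `<=` O -> connected (O `\` T) -> connected (V `\` T).
Proof.
move=> oV /connected_openP cV cT oO OV VTO cOT; apply/connected_openP.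
have H U1 U2 : open U1 -> open U2 -> V `\` T `<=` U1 `|` U2 ->
    (forall x, (V `\` T) x -> U1 x -> U2 x -> False) ->
    (V `\` T) `&` U1 !=set0 -> (V `\` T) `&` U2 !=set0 ->
    (forall x, (O `\` T) x -> U1 x -> False) -> False.
  move=> oU1 oU2 VU dU [x1 [[Vx1 Tx1] Ux1]] [x2 [[Vx2 Tx2] Ux2]] dO.
  apply: (cV ((V `\` T) `&` U1) (((V `\` T) `&` U2) `|` O)).
  - by apply: openI => //; apply: openI => //; apply: closed_openC.
  - apply: openU => //; apply: openI => //; apply: openI => //; exact: closed_openC.
  - move=> x Vx; have [Tx|nTx] := pselect (T x); first by right; right; apply: VTO.
    by case: (VU x) => //; [left|right; left].
  - move=> x _ [VTx U1x] [[_ U2x]|Ox]; first exact: (dU x).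
    by apply: (dO x) => //; split => //; case: VTx.
  - by exists x1.
  - by exists x2; split => //; left.
move=> U1 U2 oU1 oU2 VU dU ne1 ne2.
have [[x1 [OTx1 Ux1]]|n1] := pselect (exists x, (O `\` T) x /\ U1 x); last first.
  by apply: (H U1 U2) => // x xO xU; apply: n1; exists x.
have [[x2 [OTx2 Ux2]]|n2] := pselect (exists x, (O `\` T) x /\ U2 x); last first.
  apply: (H U2 U1) => //.
  - by move=> x /VU [|]; [right|left].
  - by move=> x a b c; apply: (dU x).
  - by move=> x xO xU; apply: n2; exists x.
move/connected_openP: cOT => /(_ U1 U2); apply => //.
- by move=> x [Ox Tx]; apply: VU; split => //; apply: OV.
- by move=> x [Ox Tx]; apply: dU; split => //; apply: OV.
- by exists x1.
- by exists x2.
Qed.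

Definition ninterior k p C := C `\` nboundary k p.

(* [C] is the closed region bounded by the polygon. *)
Definition good k p C := [/\ nsimple k p,
  [/\ nboundary k p `<=` C, closed C & bounded_set C],
  open (ninterior k p C), nboundary k p `<=` closure (ninterior k p C) &
  connected (~` C)].

Section Step.
Variables (k : nat) (p : nat -> K * K) (C : set (K * K)) (l m : K * K -> K)
  (g : K -> K -> K * K) (i0 : nat) (s1 s2 eta d : K).
Hypotheses (gd : good k p C) (fr : frame l m g) (i0k : (i0 < k)%N).
Hypotheses (s1_gt0 : 0 < s1) (s12 : s1 < s2) (s2_lt1 : s2 < 1)
  (eta_gt0 : 0 < eta) (d_gt0 : 0 < d) (d_lt : d < 1 / 2).
Hypotheses (e1 : nalong p i0 s1 = g 1 0) (e2 : nalong p i0 s2 = g 0 1).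
(** The slack [eta] provides a boundary-free strip just beyond the chord; without it nothing would
    tell that this strip is interior. *)
Hypothesis bnd_line : forall x, 0 <= l x -> 0 <= m x -> l x + m x <= 1 + eta ->
  nboundary k p x -> l x + m x = 1.
Hypothesis apex_out : ~ C (g 0 0).

(* The side [i0] lies on [l x + m x = 1], [T] is the spike, and [W] is its
   interior prolonged across that side. *)
Let T : set (K * K) := [set x | [/\ d <= l x, d <= m x & l x + m x <= 1]].
Let W : set (K * K) := [set x | [/\ d < l x, d < m x & l x + m x < 1 + eta]].
Local Notation p' := (insert3 p i0 (g (1 - d) d) (g d d) (g d (1 - d))).

Let lg a b : l (g a b) = a.
Proof. by have [_ _ /(_ a b)[]] := fr. Qed.
Let mg a b : m (g a b) = b.
Proof. by have [_ _ /(_ a b)[]] := fr. Qed.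
Let al : affine l. Proof. by case: fr. Qed.
Let am : affine m. Proof. by case: fr. Qed.
Let alm : affine (fun x => l x + m x). Proof. exact: affineD. Qed.

Let along_frame s : l (nalong p i0 s) = (s2 - s) / (s2 - s1) /\
  m (nalong p i0 s) = (s - s1) / (s2 - s1).
Proof.
have h : s2 - s1 != 0 by apply: lt0r_neq0; move: s12; lra.
have E f : affine f -> f (nalong p i0 s) = ((s2 - s) * f (nalong p i0 s1) +
    (s - s1) * f (nalong p i0 s2)) / (s2 - s1).
  by move=> [a [b [c fE]]]; rewrite !fE /nalong /=; field.
by split; rewrite E // e1 e2 ?lg ?mg; field.
Qed.

Let bnd_chord x : 0 <= l x -> 0 <= m x -> l x + m x = 1 -> nboundary k p x.
Proof.
move=> l0 m0 lm1; exists i0 => //; apply/segmentP.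
move: (s12) (s1_gt0) (s2_lt1) => h12 h1 h2.
have h : s2 - s1 != 0 by apply: lt0r_neq0; lra.
exists (s1 + m x * (s2 - s1)).
  have ? : 0 <= m x * (s2 - s1) by apply: mulr_ge0; lra.
  have ? : 0 <= (1 - m x) * (s2 - s1) by apply: mulr_ge0; lra.
  by lra.
rewrite -/(nalong p i0 _); apply: (frame_inj fr).
  by have [-> _] := along_frame (s1 + m x * (s2 - s1)); have -> : l x = 1 - m x; [lra|field].
by have [_ ->] := along_frame (s1 + m x * (s2 - s1)); field.
Qed.

(** The part of the cone before the chord is convex and free of boundary, and its apex is outside
    [C]. *)
Let before_out x : 0 <= l x -> 0 <= m x -> l x + m x < 1 -> ~ C x.
Proof.
move=> l0 m0 lm; have [_ [bC cC _] oU _ _] := gd.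
pose A : set (K * K) := [set x | 0 <= l x] `&` [set x | 0 <= m x] `&` [set x | l x + m x < 1].
have cA : connected A.
  apply: convex_connected; apply: convexI; first apply: convexI.
  - by apply: convex_affine_le => //; apply: affine_cst.
  - by apply: convex_affine_le => //; apply: affine_cst.
  - by apply: convex_affine_lt => //; apply: affine_cst.
have : A `<=` ~` C.
  apply: (connected_sub_open cA (closed_openC cC) oU).
  - move=> y [[/= ly my] lmy]; have [Cy|] := pselect (C y); last by left.
    right; split => // by_; move: (eta_gt0) => ?.
    by have := bnd_line ly my _ by_; lra.
  - by move=> y _ nC [].
  - exists (g 0 0); split => //; split => /=; rewrite ?lg ?mg; first by split => /=; rewrite ?lg ?mg.
    lra.
by apply; split.
Qed.

(** The strip beyond the chord is convex and free of boundary, so one interior point in it is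
    enough. The midpoint of the chord is a limit of interior points, and those close to it can lie
    neither on the chord nor before it. *)
Let after_in x : 0 < l x -> 0 < m x -> 1 < l x + m x -> l x + m x < 1 + eta ->
  ninterior k p C x.
Proof.
move=> l0 m0 lm lm'; have [_ [bC cC _] oU bU _] := gd; move: (eta_gt0) => eg.
pose N : set (K * K) := [set x | 0 < l x] `&` [set x | 0 < m x] `&` [set x | l x + m x < 1 + eta].
pose A : set (K * K) := N `&` [set x | 1 < l x + m x].
have aff0 c := @affine_cst K c.
have oN : open N.
  by apply: openI; [apply: openI|]; apply: open_affine_lt.
have cA : connected A.
  apply: convex_connected; apply: convexI; [apply: convexI; [apply: convexI|]|];
    exact: convex_affine_lt.
have Nh : N (g (1 / 2) (1 / 2)).
  by split; [split|]; rewrite /= ?lg ?mg; lra.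
have bh : nboundary k p (g (1 / 2) (1 / 2)).
  by apply: bnd_chord; rewrite ?lg ?mg; lra.
have [y [Uy Ny]] := bU _ bh N (open_nbhs_nbhs (conj oN Nh)).
have Ay : A y.
  split => //=; case: Ny => -[/= ly my] lmy; rewrite ltNge le_eqVlt; apply/negP => /orP[/eqP e|e].
    by case: Uy => _; apply; apply: bnd_chord; lra.
  by have := @before_out y ltac:(lra) ltac:(lra) e; apply; case: Uy.
have : A `<=` ninterior k p C.
  apply: (connected_sub_open cA oU (closed_openC cC)).
  - move=> z [[[/= lz mz] lmz] lmz']; have [Cz|] := pselect (C z); last by right.
    left; split => // bz; have := bnd_line (ltW lz) (ltW mz) (ltW lmz) bz; lra.
  - by move=> z _ [].
  - by exists y.
by apply; split => //; split.
Qed.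

Let w1E : g (1 - d) d = nalong p i0 (s1 + d * (s2 - s1)).
Proof.
have h : s2 - s1 != 0 by apply: lt0r_neq0; move: s12; lra.
have [a b] := along_frame (s1 + d * (s2 - s1)).
by apply: (frame_inj fr); rewrite ?a ?b ?lg ?mg; field.
Qed.

Let w2E : g d (1 - d) = nalong p i0 (s1 + (1 - d) * (s2 - s1)).
Proof.
have h : s2 - s1 != 0 by apply: lt0r_neq0; move: s12; lra.
have [a b] := along_frame (s1 + (1 - d) * (s2 - s1)).
by apply: (frame_inj fr); rewrite ?a ?b ?lg ?mg; field.
Qed.

Let w1qP x : segment (g (1 - d) d) (g d d) x <-> m x = d /\ d <= l x <= 1 - d.
Proof.
move: (d_lt) (d_gt0) => dl dg.
split=> [/(frame_segment _ _ _ fr)[t t01]|[mx lx]].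
  rewrite !lg !mg => -[-> ->]; case/andP: t01 => t0 t1; split; first by ring.
  have ? : 0 <= t * (1 - 2 * d) by apply: mulr_ge0; lra.
  have ? : 0 <= (1 - t) * (1 - 2 * d) by apply: mulr_ge0; lra.
  by lra.
apply/(frame_segment _ _ _ fr); rewrite !lg !mg.
have h : 1 - 2 * d != 0 by apply: lt0r_neq0; lra.
exists ((1 - d - l x) / (1 - 2 * d)).
  by apply/andP; split; [apply: divr_ge0; lra|rewrite ler_pdivrMr; lra].
by rewrite mx; split; field.
Qed.

Let qw2P x : segment (g d d) (g d (1 - d)) x <-> l x = d /\ d <= m x <= 1 - d.
Proof.
move: (d_lt) (d_gt0) => dl dg.
split=> [/(frame_segment _ _ _ fr)[t t01]|[mx lx]].
  rewrite !lg !mg => -[-> ->]; case/andP: t01 => t0 t1; split; first by ring.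
  have ? : 0 <= t * (1 - 2 * d) by apply: mulr_ge0; lra.
  have ? : 0 <= (1 - t) * (1 - 2 * d) by apply: mulr_ge0; lra.
  by lra.
apply/(frame_segment _ _ _ fr); rewrite !lg !mg.
have h : 1 - 2 * d != 0 by apply: lt0r_neq0; lra.
exists ((m x - d) / (1 - 2 * d)).
  by apply/andP; split; [apply: divr_ge0; lra|rewrite ler_pdivrMr; lra].
by rewrite mx; split; field.
Qed.

Let ranges : [/\ 0 < s1 + d * (s2 - s1),
  s1 + d * (s2 - s1) < s1 + (1 - d) * (s2 - s1) & s1 + (1 - d) * (s2 - s1) < 1].
Proof.
move: (s12) (s1_gt0) (s2_lt1) (d_lt) (d_gt0) => h12 h1 h2 dl dg.
have ? : 0 < d * (s2 - s1) by apply: mulr_gt0; lra.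
have ? : 0 < (1 - 2 * d) * (s2 - s1) by apply: mulr_gt0; lra.
by split; lra.
Qed.

Let along_mid x : (exists2 s : K, s1 + d * (s2 - s1) < s < s1 + (1 - d) * (s2 - s1) &
  x = nalong p i0 s) <-> [/\ d < l x, d < m x & l x + m x = 1].
Proof.
move: (s12) (s1_gt0) (s2_lt1) (d_lt) (d_gt0) => h12 h1 h2 dl dg.
have h' : 0 < s2 - s1 by lra.
have h : s2 - s1 != 0 by apply: lt0r_neq0.
split=> [[s ss ->]|[lx mx lm]].
  have [-> ->] := along_frame s; rewrite !ltr_pdivlMr //; split; [lra|lra|by field].
exists (s1 + m x * (s2 - s1)).
  rewrite !ltrD2l !ltr_pM2r //; lra.
have [a b] := along_frame (s1 + m x * (s2 - s1)).
have lE : l x = 1 - m x by lra.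
by apply: (frame_inj fr); rewrite ?a ?b ?lE; field.
Qed.

Let simple' : nsimple (k + 3) p'.
Proof.
have [sp [bC _ _] _ _ _] := gd; have [r1 r2 r3] := ranges.
move: (d_lt) (d_gt0) (eta_gt0) => dl dg eg.
apply: (insert3_simple sp i0k r1 r2 r3 w1E w2E).
- by move=> /bC; apply: before_out; rewrite ?lg ?mg; lra.
- move=> x /w1qP[mx lx] bx; apply: (frame_inj fr); rewrite ?lg ?mg ?mx //.
  by have := @bnd_line x; rewrite mx => /(_ _ _ _ bx); lra.
- move=> x /qw2P[mx lx] bx; apply: (frame_inj fr); rewrite ?lg ?mg ?mx //.
  by have := @bnd_line x; rewrite mx => /(_ _ _ _ bx); lra.
- by move=> x /w1qP[mx _] /qw2P[lx _]; apply: (frame_inj fr); rewrite ?lg ?mg.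
Qed.

Let boundary'P x : nboundary (k + 3) p' x <->
  [\/ nboundary k p x /\ ~ [/\ d < l x, d < m x & l x + m x = 1],
      m x = d /\ d <= l x <= 1 - d | l x = d /\ d <= m x <= 1 - d].
Proof.
have [sp _ _ _ _] := gd; have [r1 r2 r3] := ranges.
split.
  move=> /(insert3_boundary_new sp i0k r1 r2 r3 w1E w2E)[[bx nx]|/w1qP|/qw2P]; last 2 first.
  - by constructor 2.
  - by constructor 3.
  constructor 1; split=> // /along_mid[s ss xE]; exact: (nx s).
case=> [[bx nx]|/w1qP h|/qw2P h].
- apply: (insert3_boundary_old (g d d) i0k r1 r2 r3 w1E w2E) => //.
  by move=> s ss e; apply: nx; apply/along_mid; exists s.
- by apply/(insert3_boundary p _ _ _ i0k r1 r2 r3); do 3 right; left.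
- by apply/(insert3_boundary p _ _ _ i0k r1 r2 r3); do 4 right.
Qed.

(** The open middle part of the chord is no longer boundary. It joins the open spike to the strip
    beyond the chord, and [W] is the union of these three pieces. *)
Let interior' : ninterior (k + 3) p' (C `|` T) = ninterior k p C `|` W.
Proof.
move: (d_lt) (d_gt0) (eta_gt0) => dl dg eg.
have [_ [bC _ _] _ _ _] := gd.
apply/seteqP; split=> x.
  move=> [CT nb]; have [lmx|lmx] := pselect [/\ d < l x, d < m x & l x + m x = 1].
    by right; case: lmx => *; split => //; lra.
  case: CT => [Cx|[lx mx lm]].
    by left; split => // bx; apply: nb; apply/boundary'P; constructor 1.
  right; split; last lra.
    by rewrite lt_neqAle lx andbT; apply/eqP => e; apply: nb; apply/boundary'P; constructor 3; lra.
  by rewrite lt_neqAle mx andbT; apply/eqP => e; apply: nb; apply/boundary'P; constructor 2; lra.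
move=> [[Cx nb]|[lx mx lm]].
  split; first by left.
  have Q : 0 <= l x -> 0 <= m x -> l x + m x <= 1 -> False.
    move=> l0 m0; rewrite le_eqVlt => /orP[/eqP e|e]; first by apply: nb; apply: bnd_chord.
    exact: before_out Cx.
  move=> /boundary'P[[bx _]|[h1 h2]|[h1 h2]] //; apply: Q; lra.
split.
  have [h|h] := leP (l x + m x) 1; first by right; split; lra.
  by left; have [] : ninterior k p C x by apply: after_in; lra.
move=> /boundary'P[[bx nb]|[h1 h2]|[h1 h2]]; [|lra|lra].
by apply: nb; split => //; apply: bnd_line => //; lra.
Qed.

(** The collar consists of two convex strips, [l x < d] and [m x < d], which overlap near the
    apex. *)
Let collar_connected : connected
  (([set x | 0 < l x] `&` [set x | 0 < m x] `&` [set x | l x + m x < 1]) `\` T).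
Proof.
move: (d_lt) (d_gt0) (eta_gt0) => dl dg eg; have aff0 c := @affine_cst K c.
set O := _ `&` _ `&` _.
have cO : convex_set O.
  by apply: convexI; [apply: convexI|]; apply: convex_affine_lt.
have -> : O `\` T = (O `&` [set x | l x < d]) `|` (O `&` [set x | m x < d]).
  apply/seteqP; split=> x.
    move=> [Ox nT]; have [h|h] := ltP (l x) d; first by left.
    have [h'|h'] := ltP (m x) d; first by right.
    by exfalso; apply: nT; split => //; case: Ox => _ /= /ltW.
  by move=> [[Ox /= h]|[Ox /= h]]; split => // -[]; lra.
apply: connectedU.
- exists (g (d / 2) (d / 2)); split; (split; [split; [split|]|]); rewrite /= ?lg ?mg; lra.
- by apply: convex_connected; apply: convexI => //; apply: convex_affine_lt.
- by apply: convex_connected; apply: convexI => //; apply: convex_affine_lt.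
Qed.

Lemma attach_spike : exists p' : nat -> K * K, [/\ good (k + 3) p' (C `|` T),
  ninterior k p C `<=` ninterior (k + 3) p' (C `|` T) &
  forall x, d < l x -> d < m x -> l x + m x <= 1 -> ninterior (k + 3) p' (C `|` T) x].
Proof.
move: (d_lt) (d_gt0) (eta_gt0) => dl dg eg; have aff0 c := @affine_cst K c.
exists p'; rewrite interior'; split; last 2 first.
- by move=> x; left.
- by move=> x lx mx lm; right; split => //; lra.
have [sp [bC cC boC] oU bU cV] := gd.
have oW : open W.
  rewrite (_ : W = [set x | d < l x] `&` [set x | d < m x] `&` [set x | l x + m x < 1 + eta]).
    by apply: openI; [apply: openI|]; apply: open_affine_lt.
  by apply/seteqP; split=> x /=; [case|case; case].
have cT : closed T.
  rewrite (_ : T = [set x | d <= l x] `&` [set x | d <= m x] `&` [set x | l x + m x <= 1]).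
    by apply: closedI; [apply: closedI|]; apply: closed_affine_le.
  by apply/seteqP; split=> x /=; [case|case; case].
(* Pushing [x] towards the midpoint of the chord makes the three inequalities strict, since
   [d < 1 / 2]. *)
have W_T x : T x -> closure W x.
  move=> [lx mx lm]; apply: (@closure_convexcomb _ W x (g (1 / 2) (1 / 2))) => t t01.
  have [t0 t1] := andP t01; split; rewrite ?affine_segment // ?lg ?mg; last first.
  + have ? : 0 <= (1 - t) * (1 - (l x + m x)) by apply: mulr_ge0; lra.
    lra.
  + have ? : 0 <= (1 - t) * (m x - d) by apply: mulr_ge0; lra.
    have ? : 0 < t * (1 / 2 - d) by apply: mulr_gt0; lra.
    lra.
  + have ? : 0 <= (1 - t) * (l x - d) by apply: mulr_ge0; lra.
    have ? : 0 < t * (1 / 2 - d) by apply: mulr_gt0; lra.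
    lra.
split=> //; last 3 first.
- by rewrite interior'; apply: openU.
- rewrite interior' closureU => x /boundary'P[[bx _]|h|h]; first by left; apply: bU.
    by right; apply: W_T; split; lra.
  by right; apply: W_T; split; lra.
(* The open triangle before the chord serves as neighbourhood of the spike: it misses [C], and it
   contains all of [T] except the base, which lies on the old boundary and so in [C]. *)
- rewrite setCU -setDE; apply: (@connected_setD _ _ ([set x | 0 < l x] `&` [set x | 0 < m x] `&` [set x | l x + m x < 1])) => //.
  + exact: closed_openC.
  + by apply: openI; [apply: openI|]; apply: open_affine_lt.
  + by move=> x [[/= l0 m0] lm]; apply: before_out => //; lra.
  + move=> x [nC [lx mx lm]]; split; [split => /=; lra|] => /=.
    rewrite lt_neqAle lm andbT; apply/eqP => e; apply: nC; apply: bC.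
    by apply: bnd_chord; lra.
split.
- move=> x /boundary'P[[bx _]|h|h]; first by left; apply: bC.
    by right; split; lra.
  by right; split; lra.
- exact: closedU.
- apply: bounded_setU2 => //; have /bounded_setP[M HM] := frame_triangle_bounded fr.
  by apply/bounded_setP; exists M => x [lx mx lm]; apply: HM; split; lra.
Qed.

End Step.
End Attach.

(** * Conditions that hold for all sufficiently small positive numbers *)

Section Small.
Variable K : realType.
Implicit Types (P Q : K -> Prop) (c : K).

Definition small P := exists2 e : K, 0 < e & forall e', 0 < e' <= e -> P e'.

Lemma smallI P Q : small P -> small Q -> small (fun e => P e /\ Q e).
Proof.
move=> [a a0 Pa] [b b0 Qb]; exists (Num.min a b); first by rewrite lt_min a0.
by move=> e; rewrite le_min => /andP[e0 /andP[ea eb]]; split; [apply: Pa|apply: Qb]; rewrite e0.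
Qed.

Lemma smallW P Q : (forall e, 0 < e -> P e -> Q e) -> small P -> small Q.
Proof. by move=> PQ [e e0 He]; exists e => // e' /[dup] /andP[e'0 _] h; apply: PQ => //; apply: He. Qed.

Lemma small_ex P : small P -> exists2 e : K, 0 < e & P e.
Proof. by move=> [e e0 H]; exists e => //; apply: H; rewrite e0 lexx. Qed.

Lemma small_all (T : eqType) (s : seq T) (P : T -> K -> Prop) :
  (forall x, x \in s -> small (P x)) -> small (fun e => forall x, x \in s -> P x e).
Proof.
elim: s => [|a s IH] H; first by exists 1.
have Ha := H a (mem_head _ _).
have /IH Hs : forall x, x \in s -> small (P x) by move=> x xs; apply: H; rewrite inE xs orbT.
apply: smallW (smallI Ha Hs) => e _ [Pa Ps] x; rewrite inE => /orP[/eqP -> //|]; exact: Ps.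
Qed.

Lemma small_nat (k : nat) (P : nat -> K -> Prop) :
  (forall j, (j < k)%N -> small (P j)) -> small (fun e => forall j, (j < k)%N -> P j e).
Proof.
move=> H; have : forall j, j \in iota 0 k -> small (P j).
  by move=> j; rewrite mem_iota /= add0n; apply: H.
move/small_all; apply: smallW => e _ He j jk; apply: He.
by rewrite mem_iota add0n.
Qed.

Lemma small_mul_lt a c : 0 < c -> small (fun e => e * a < c).
Proof.
move=> c0; have a0 := normr_ge0 a; have h : 0 < `|a| + 1 by lra.
(* The added 1 keeps the denominator positive when [a = 0]. *)
exists (c / (`|a| + 1)); first exact: divr_gt0.
move=> e /andP[e0]; rewrite ler_pdivlMr // => ec.
have : e * a <= e * `|a| by rewrite ler_pM2l // ler_norm.
lra.
Qed.

Lemma small_lt c : 0 < c -> small (fun e => e < c).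
Proof. by move=> /(small_mul_lt 1); apply: smallW => e _; rewrite mulr1. Qed.

End Small.

(** * How segments cross a triangle *)

Section Cone.
Variable K : realType.
Implicit Types (p : nat -> K * K) (x y z q w : K * K) (s t : K)
  (C : set (K * K)) (l m : K * K -> K) (g : K -> K -> K * K).

(** Clips a segment against one half-plane, going backwards from a point inside it; [a] and [b] are
    the values of the defining affine function at the end points. *)
Lemma clip_ge0 (a b s : K) : 0 <= s <= 1 -> 0 <= a + s * (b - a) ->
  exists2 t : K, 0 <= t <= s & (forall t', t <= t' <= s -> 0 <= a + t' * (b - a)) /\
    (t = 0 /\ 0 <= a \/ a < 0 /\ a + t * (b - a) = 0).
Proof.
move=> /andP[s0 s1] fs; have [a0|a0] := leP 0 a.
  exists 0; first by rewrite lexx.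
  split; last by left.
  move=> t /andP[t0 ts]; have [b0|b0] := leP a b.
    have : 0 <= t * (b - a) by apply: mulr_ge0 => //; lra.
    lra.
  have : 0 <= (s - t) * (a - b) by apply: mulr_ge0; lra.
  lra.
have ab : 0 < b - a.
  rewrite ltNge; apply/negP => h.
  have : 0 <= s * (a - b) by apply: mulr_ge0; lra.
  lra.
have E : a + (- a / (b - a)) * (b - a) = 0 by field; apply: lt0r_neq0.
exists (- a / (b - a)).
  apply/andP; split; first by apply: divr_ge0; lra.
  by rewrite ler_pdivrMr //; lra.
split; last by right.
move=> t /andP[t0 _].
have : 0 <= (t - (- a / (b - a))) * (b - a) by apply: mulr_ge0; lra.
lra.
Qed.

Definition in_triangle l m x := [/\ 0 <= l x, 0 <= m x & l x + m x <= 1].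

(** Clip against the three half-planes and keep the largest entry parameter. It is nonzero because
    [a] is outside the triangle, so the constraint that attains it is violated at [a] and tight at
    [z]. *)
Lemma segment_entry l m g a b x : frame l m g -> ~ in_triangle l m a ->
  segment a b x -> in_triangle l m x ->
  exists2 z, segment a b z & in_triangle l m z /\
    [\/ l z = 0 /\ l a < 0, m z = 0 /\ m a < 0 | l z + m z = 1].
Proof.
move=> fr na /segmentP[s s01 ->]; have [al am _ _ _] := fr.
have an : affine (fun x => 1 - (l x + m x)).
  by apply: affineB; [exact: affine_cst|exact: affineD].
have cl t f (af : affine f) := affine_segment a b t af.
have cln t := affine_segment a b t an.
move=> [l0 m0 n0].
move: l0; rewrite cl // => /(clip_ge0 s01)[t1 t1s [P1 Q1]].
move: m0; rewrite cl // => /(clip_ge0 s01)[t2 t2s [P2 Q2]].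
have : 0 <= 1 - (l (a.1 + s * (b.1 - a.1), a.2 + s * (b.2 - a.2)) +
         m (a.1 + s * (b.1 - a.1), a.2 + s * (b.2 - a.2))) by lra.
rewrite cln => /(clip_ge0 s01)[t3 t3s [P3 Q3]] {n0}.
pose t := Num.max t1 (Num.max t2 t3).
have [h1 h2 h3 h4] : [/\ t1 <= t, t2 <= t, t3 <= t & t <= s].
  by rewrite /t !le_max !ge_max !lexx ?orbT; split => //; lra.
have t0 : 0 <= t by lra.
exists (a.1 + t * (b.1 - a.1), a.2 + t * (b.2 - a.2)).
  by apply/segmentP; exists t => //; lra.
have z1 : 0 <= l (a.1 + t * (b.1 - a.1), a.2 + t * (b.2 - a.2)) by rewrite cl //; apply: P1; lra.
have z2 : 0 <= m (a.1 + t * (b.1 - a.1), a.2 + t * (b.2 - a.2)) by rewrite cl //; apply: P2; lra.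
have z3 : 0 <= 1 - (l (a.1 + t * (b.1 - a.1), a.2 + t * (b.2 - a.2)) +
         m (a.1 + t * (b.1 - a.1), a.2 + t * (b.2 - a.2))) by rewrite cln; apply: P3; lra.
split; first by split => //; lra.
have nt0 : t <> 0.
  move=> t00; apply: na; move: z1 z2 z3; rewrite t00 !mul0r !addr0 -surjective_pairing => *.
  by split => //; lra.
have : t = t1 \/ t = t2 \/ t = t3.
  by rewrite /t /Num.max; case: ifP => _; [case: ifP => _|]; auto.
case=> [e|[e|e]].
- case: Q1 => [[e' _]|[la e']]; first by lra.
  by constructor 1; rewrite cl // e.
- case: Q2 => [[e' _]|[la e']]; first by lra.
  by constructor 2; rewrite cl // e.
- case: Q3 => [[e' _]|[la e']]; first by lra.
  by constructor 3; move: e'; rewrite -e -cln; lra.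
Qed.

(** Seen from either end, the segment enters the triangle through one of the two edges at the apex.
    It cannot be the same edge twice: an affine function negative at both ends does not vanish in
    between. *)
Lemma segment_chord l m g a b x : frame l m g ->
  ~ in_triangle l m a -> ~ in_triangle l m b ->
  (forall y, segment a b y -> in_triangle l m y -> l y + m y <> 1) ->
  ~ segment a b (g 0 0) ->
  segment a b x -> in_triangle l m x ->
  exists t u : K, [/\ 0 < t < 1, 0 < u < 1, segment a b (g t 0) & segment a b (g 0 u)].
Proof.
move=> fr na nb nn nq sx tx; have [al am glm gK _] := fr.
have [z sz [tz Hz]] := segment_entry fr na sx tx.
have sx' := sx; rewrite segmentC in sx'.
have [z' sz' [tz' Hz']] := segment_entry fr nb sx' tx.
rewrite segmentC in sz'.
have H y : segment a b y -> in_triangle l m y ->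
    (l y = 0 -> 0 < m y < 1 /\ y = g 0 (m y)) /\ (m y = 0 -> 0 < l y < 1 /\ y = g (l y) 0).
  move=> sy ty; have ny := nn _ sy ty; case: ty => l0 m0 lm.
  have nz : ~ (l y = 0 /\ m y = 0).
    by move=> [e e']; apply: nq; rewrite -[g 0 0](_ : y = _) // -{1}(gK y) e e'.
  split=> e; split; try by rewrite -{1}(gK y) e.
    rewrite e add0r in lm ny; rewrite !lt_neqAle m0 lm !andbT; apply/andP; split; apply/eqP => //.
    by move=> e'; apply: nz.
  rewrite e addr0 in lm ny; rewrite !lt_neqAle l0 lm !andbT; apply/andP; split; apply/eqP => //.
  by move=> e'; apply: nz.
have [Hz1 Hz2] := H z sz tz; have [Hz'1 Hz'2] := H z' sz' tz'.
have neg f : affine f -> f a < 0 -> f b < 0 -> f z = 0 -> False.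
  move=> af fa fb; move/segmentP: sz => [t t01 ->]; rewrite affine_segment //.
  case/andP: t01 => t0 t1.
  have h1 : 0 <= t * - f b by apply: mulr_ge0 => //; lra.
  have h2 : 0 <= (1 - t) * - f a by apply: mulr_ge0 => //; lra.
  have [h|h] := ltP t (1 / 2).
    have : 0 < (1 - t) * - f a by apply: mulr_gt0; lra.
    lra.
  have : 0 < t * - f b by apply: mulr_gt0; lra.
  lra.
case: Hz => [[e ea]|[e ea]|e]; last by case: (nn _ sz tz).
  case: Hz' => [[e' eb]|[e' eb]|e']; last by case: (nn _ sz' tz').
    by case: (neg l).
  have [u01 zE] := Hz1 e; have [t01 z'E] := Hz'2 e'.
  by exists (l z'), (m z); rewrite -z'E -zE.
case: Hz' => [[e' eb]|[e' eb]|e']; last by case: (nn _ sz' tz').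
  have [u01 zE] := Hz2 e; have [t01 z'E] := Hz'1 e'.
  by exists (l z), (m z'); rewrite -z'E -zE.
by case: (neg m).
Qed.

(** The affine function [l x / t + m x / u] takes the value 1 at two distinct points of the segment,
    hence on all of it. *)
Lemma segment_chord_line l m g a b x (t u : K) : frame l m g -> 0 < t -> 0 < u ->
  segment a b (g t 0) -> segment a b (g 0 u) -> segment a b x ->
  l x / t + m x / u = 1.
Proof.
move=> fr t0 u0 /(frame_segment _ _ _ fr)[r r01] + /(frame_segment _ _ _ fr)[s s01] +
  /(frame_segment _ _ _ fr)[w w01 [-> ->]].
have [_ _ glm _ _] := fr; have [-> ->] := glm t 0; have [-> ->] := glm 0 u.
move=> [e1 e2] [e3 e4].
have tn : t != 0 by apply: lt0r_neq0.
have un : u != 0 by apply: lt0r_neq0.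
set la := l a in e1 e2 e3 e4 *; set lb := l b in e1 e2 e3 e4 *.
set ma := m a in e1 e2 e3 e4 *; set mb := m b in e1 e2 e3 e4 *.
have rs : r - s != 0.
  apply: contra_neq tn => rs; have rsE : r = s by lra.
  by rewrite e1 rsE -e3.
have E1 : (lb - la) / t + (mb - ma) / u = 0.
  apply: (mulfI rs); rewrite mulr0.
  have -> : (r - s) * ((lb - la) / t + (mb - ma) / u) =
    (la + r * (lb - la)) / t - (la + s * (lb - la)) / t +
    ((ma + r * (mb - ma)) / u - (ma + s * (mb - ma)) / u) by field; rewrite tn un.
  by rewrite -e1 -e2 -e3 -e4; field; rewrite tn un.
have -> : (la + w * (lb - la)) / t + (ma + w * (mb - ma)) / u =
  (la + r * (lb - la)) / t + (ma + r * (mb - ma)) / u +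
  (w - r) * ((lb - la) / t + (mb - ma) / u) by field; rewrite tn un.
by rewrite E1 -e1 -e2; field; rewrite tn un.
Qed.

Lemma chords_cross l m g (t u t' u' : K) : frame l m g ->
  0 < t -> t < t' < 1 -> 0 < u' -> u' <= u -> u < 1 ->
  exists2 x, in_triangle l m x & segment (g t 0) (g 0 u) x /\ segment (g t' 0) (g 0 u') x.
Proof.
move=> fr t0 /andP[tt t1] u0 uu u1; have [_ _ glm _ _] := fr.
have LG a b : l (g a b) = a by case: (glm a b).
have MG a b : m (g a b) = b by case: (glm a b).
have D : 0 < u * t' - t * u'.
  have : 0 < u' * (t' - t) by apply: mulr_gt0; lra.
  have : 0 <= (u - u') * t' by apply: mulr_ge0; lra.
  lra.
have Dn : u * t' - t * u' != 0 by apply: lt0r_neq0.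
(* Substituting the point [g (t * (1 - r)) (u * r)] of the first chord into the equation of the
   second one and solving for [r]. *)
pose r := u' * (t' - t) / (u * t' - t * u').
have r0 : 0 <= r by apply: divr_ge0; [apply: mulr_ge0|]; lra.
have ut : 0 <= (u - u') * t' by apply: mulr_ge0; lra.
have r1 : r <= 1 by rewrite ler_pdivrMr // mul1r; lra.
exists (g (t * (1 - r)) (u * r)).
  have ? : 0 <= t * (1 - r) by apply: mulr_ge0; lra.
  have ? : 0 <= u * r by apply: mulr_ge0; lra.
  have ? : 0 <= (1 - t) * (1 - r) by apply: mulr_ge0; lra.
  have ? : 0 <= (1 - u) * r by apply: mulr_ge0; lra.
  by split; rewrite ?LG ?MG //; lra.
split; apply/(frame_segment _ _ _ fr); rewrite !LG !MG.
  by exists r; [lra|split; ring].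
have u'n : u' != 0 by apply: lt0r_neq0.
exists (u * (t' - t) / (u * t' - t * u')).
  apply/andP; split; first by apply: divr_ge0; [apply: mulr_ge0|]; lra.
  rewrite ler_pdivrMr // mul1r.
  have : 0 <= t * (u - u') by apply: mulr_ge0; lra.
  lra.
by rewrite /r; split; field.
Qed.

End Cone.

(** * Attaching a spike along a cone that the polygon may cross several times *)

Section AttachCone.
Variable K : realType.
Implicit Types (p : nat -> K * K) (x y z q w : K * K) (s t : K)
  (C : set (K * K)) (l m : K * K -> K) (g : K -> K -> K * K).

Lemma exists_min_nat (k : nat) (P : nat -> Prop) (f : nat -> K) :
  (exists2 j, (j < k)%N & P j) ->
  exists2 i, (i < k)%N /\ P i & forall j, (j < k)%N -> P j -> f i <= f j.
Proof.
elim: k => [|k IH] [j jk Pj]; first by [].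
have [[i ik Pi]|no] := pselect (exists2 j, (j < k)%N & P j); last first.
  have jE : j = k.
    by apply/eqP; rewrite eqn_leq -ltnS jk leqNgt; apply/negP => h; apply: no; exists j.
  exists j => // j' j'k Pj'; have -> // : j' = j; rewrite jE.
  by apply/eqP; rewrite eqn_leq -ltnS j'k leqNgt; apply/negP => h; apply: no; exists j'.
have [i0 [i0k Pi0] Hi0] := IH (ex_intro2 _ _ i ik Pi).
have [[Pk lt]|nk] := pselect (P k /\ f k < f i0).
  exists k => // j'; rewrite ltnS leq_eqVlt => /orP[/eqP -> //|j'k Pj'].
  exact: le_trans (ltW lt) (Hi0 _ j'k Pj').
exists i0; first by split => //; apply: ltnW.
move=> j'; rewrite ltnS leq_eqVlt => /orP[/eqP -> Pk|]; last exact: Hi0.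
by rewrite leNgt; apply/negP => lt; apply: nk.
Qed.

Lemma side_inter_vertex k p i j x : nsimple k p -> (i < k)%N -> (j < k)%N -> i <> j ->
  nside p i x -> nside p j x -> exists2 v, (v < k)%N & x = p v.
Proof.
move=> [k3 _ _ sim] ik jk ij xi xj.
have [h|h] : (i < j)%N \/ (j < i)%N by lia.
  have [[_ e]|[_ _ e]] := sim i j x ltac:(lia) xi xj; first by exists j.
  by exists 0%N => //; lia.
have [[_ e]|[_ _ e]] := sim j i x ltac:(lia) xj xi; first by exists i.
by exists 0%N => //; lia.
Qed.

Lemma segment_convex a b : convex_set (segment a b : set (K * K)).
Proof.
move=> x y /segmentP[r /andP[r0 r1] ->] /segmentP[s /andP[s0 s1] ->] _ /segmentP[t /andP[t0 t1] ->] /=.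
apply/segmentP; exists (r + t * (s - r)); last by congr pair; ring.
have ? : 0 <= t * s by apply: mulr_ge0.
have ? : 0 <= (1 - t) * r by apply: mulr_ge0; lra.
have ? : 0 <= t * (1 - s) by apply: mulr_ge0; lra.
have ? : 0 <= (1 - t) * (1 - r) by apply: mulr_ge0; lra.
lra.
Qed.

(** The conditions on [eta] say [(1 + eta) * t < 1] and [(1 + eta) * u < 1]: the triangle cut off by
    the chord, dilated by [1 + eta], stays inside the cone. *)
Lemma chord_below_base (a b t u eta : K) : 0 <= a -> 0 <= b -> 0 < t -> 0 < u -> 0 < eta ->
  eta * t < 1 - t -> eta * u < 1 - u -> a / t + b / u <= 1 + eta -> a + b <= 1.
Proof.
move=> a0 b0 t0 u0 e0 et eu ab.
have tn : t != 0 by apply: lt0r_neq0.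
have un : u != 0 by apply: lt0r_neq0.
have h1 : 0 <= a / t * (1 - t - eta * t) by apply: mulr_ge0; [apply: divr_ge0|]; lra.
have h2 : 0 <= b / u * (1 - u - eta * u) by apply: mulr_ge0; [apply: divr_ge0|]; lra.
have aE : a / t * (1 - t - eta * t) = a / t - (1 + eta) * a by field.
have bE : b / u * (1 - u - eta * u) = b / u - (1 + eta) * b by field.
have : (1 + eta) * (a + b) <= (1 + eta) * 1 by lra.
by rewrite ler_pM2l //; lra.
Qed.

(** Here [(1 + eta) * t < t'] and [(1 + eta) * u < u'], so the dilated chord does not reach the next
    one. *)
Lemma farther_chord (a b t u t' u' eta : K) : 0 <= a -> 0 <= b -> 0 < t -> 0 < u ->
  0 < t' -> 0 < u' -> eta * t < t' - t -> eta * u < u' - u -> a / t' + b / u' = 1 ->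
  1 + eta < a / t + b / u.
Proof.
move=> a0 b0 t0 u0 t'0 u'0 et eu ab.
have aE : a / t = a / t' * (t' / t) by field; rewrite !lt0r_neq0.
have bE : b / u = b / u' * (u' / u) by field; rewrite !lt0r_neq0.
have g1 : 0 < t' / t - (1 + eta) by rewrite subr_gt0 ltr_pdivlMr //; lra.
have g2 : 0 < u' / u - (1 + eta) by rewrite subr_gt0 ltr_pdivlMr //; lra.
have q1 : 0 <= a / t' by apply: divr_ge0; lra.
have q2 : 0 <= b / u' by apply: divr_ge0; lra.
have p1 : 0 <= a / t' * (t' / t - (1 + eta)) by apply: mulr_ge0; lra.
have p2 : 0 <= b / u' * (u' / u - (1 + eta)) by apply: mulr_ge0; lra.
rewrite aE bE; have [h|h] := ltP 0 (a / t').
  have := mulr_gt0 h g1; nra.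
have h' : 0 < b / u' by lra.
have := mulr_gt0 h' g2; nra.
Qed.

Lemma ray_meets_chord l m g (t u : K) x : frame l m g -> 0 < t -> 0 < u ->
  0 < l x -> 0 < m x -> 1 < l x / t + m x / u ->
  exists2 y, segment (g 0 0) x y & segment (g t 0) (g 0 u) y.
Proof.
move=> fr t0 u0 lx mx gt; have [_ _ glm _ _] := fr.
have LG c d : l (g c d) = c by case: (glm c d).
have MG c d : m (g c d) = d by case: (glm c d).
pose r := (l x / t + m x / u)^-1.
have rgt : 0 < l x / t + m x / u by lra.
have r0 : 0 < r by rewrite invr_gt0.
have r1 : r <= 1 by rewrite invf_le1 //; lra.
have rE : r * (l x / t + m x / u) = 1 by rewrite mulVf // lt0r_neq0.
exists (g (r * l x) (r * m x)); apply/(frame_segment _ _ _ fr); rewrite !LG !MG.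
  by exists r; [lra|split; ring].
have q1 : 0 <= r * (l x / t) by apply: mulr_ge0; [|apply: divr_ge0]; lra.
have q2 : 0 <= r * (m x / u) by apply: mulr_ge0; [|apply: divr_ge0]; lra.
exists (r * (m x / u)); first by lra.
split; last by field; apply: lt0r_neq0.
have -> : r * (m x / u) = 1 - r * (l x / t) by lra.
by field; apply: lt0r_neq0.
Qed.

(** The case where side [i0] runs from the edge [m = 0] of the cone to the edge [l = 0]. Rescaling
    makes its trace the unit chord, and [d] is taken so small that the shrunken spike still has both
    points in its interior. *)
Lemma attach_cone_oriented k p C l m g (b b' : K * K) i0 (t u s1 s2 eta : K) :
  good k p C -> frame l m g -> ~ C (g 0 0) -> (i0 < k)%N ->
  0 < t < 1 -> 0 < u < 1 -> 0 < eta -> 0 < s1 -> s1 < s2 -> s2 < 1 ->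
  nalong p i0 s1 = g t 0 -> nalong p i0 s2 = g 0 u ->
  (forall x, 0 <= l x -> 0 <= m x -> l x / t + m x / u <= 1 + eta ->
    nboundary k p x -> l x / t + m x / u = 1) ->
  (forall c, c \in [:: b; b'] -> [/\ 0 < l c, 0 < m c & l c / t + m c / u <= 1]) ->
  exists p' C', [/\ good (k + 3) p' C', C `<=` C',
    C' `<=` C `|` [set x | in_triangle l m x],
    ninterior k p C `<=` ninterior (k + 3) p' C' &
    forall c, c \in [:: b; b'] -> ninterior (k + 3) p' C' c].
Proof.
move=> gd fr nq ik /andP[t0 t1] /andP[u0 u1] eg s10 s12 s21 e1 e2 bl bP.
have tn : t != 0 by apply: lt0r_neq0.
have un : u != 0 by apply: lt0r_neq0.
have fr' := frame_rescale tn un fr.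
have : small (fun d => d < 1 / 2 /\ forall c, c \in [:: b; b'] -> d < l c / t /\ d < m c / u).
  apply: smallI; first by apply: small_lt; lra.
  apply: small_all => c /bP[lc mc _].
  by apply: smallI; apply: small_lt; apply: divr_gt0.
move=> /small_ex[d d0 [d2 dP]].
have [||||p' [gd' sub inP]] := @attach_spike _ _ _ _ _ _ _ _ _ _ _ _ gd fr' ik s10 s12 s21 eg d0 d2.
- by rewrite mulr1 mulr0.
- by rewrite mulr1 mulr0.
- by move=> x lx mx; apply: bl; [move: lx|move: mx]; rewrite pmulr_lge0 // invr_gt0.
- by rewrite !mulr0.
exists p'; eexists; split; [exact: gd'|by move=> x; left| |exact: sub|].
- move=> x [Cx|[/= lx mx lm]]; [by left|right].
  have lx0 : 0 <= l x / t by lra.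
  have mx0 : 0 <= m x / u by lra.
  have lE : l x = l x / t * t by field.
  have mE : m x = m x / u * u by field.
  have ? : 0 <= l x / t * (1 - t) by apply: mulr_ge0; lra.
  have ? : 0 <= m x / u * (1 - u) by apply: mulr_ge0; lra.
  split; [by rewrite lE mulr_ge0 // ltW|by rewrite mE mulr_ge0 // ltW|].
  lra.
- by move=> c cb; have [lc mc lm] := bP c cb; have [d3 d4] := dP c cb; apply: inP.
Qed.

(* The sides of [p] crossing the cone are disjoint chords from one edge to the
   other, hence ordered; the spike is attached to the one closest to the apex. *)
Lemma attach_cone k p C l m g (b b' : K * K) :
  good k p C -> frame l m g -> ~ C (g 0 0) ->
  (forall x, in_triangle l m x -> l x + m x = 1 -> ninterior k p C x) ->
  (forall j, (j < k)%N -> ~ in_triangle l m (p j)) ->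
  (forall c, c \in [:: b; b'] -> [/\ 0 < l c, 0 < m c & segment (g 0 0) c `<=` ~` C]) ->
  exists p' C', [/\ good (k + 3) p' C', C `<=` C',
    C' `<=` C `|` [set x | in_triangle l m x],
    ninterior k p C `<=` ninterior (k + 3) p' C' &
    forall c, c \in [:: b; b'] -> ninterior (k + 3) p' C' c].
Proof.
move=> gd fr nq base vert bP.
have [sp [bC cC _] oU _ _] := gd; have [k3 pk inj sim] := sp.
have [al am glm gK _] := fr.
have LG c d : l (g c d) = c by case: (glm c d).
have MG c d : m (g c d) = d by case: (glm c d).
have vert' j : (j <= k)%N -> ~ in_triangle l m (p j).
  by rewrite leq_eqVlt => /orP[/eqP -> |]; [rewrite pk; apply: vert; lia|apply: vert].
pose hit j := exists2 x, nside p j x & in_triangle l m x.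
have side_bnd j x : (j < k)%N -> nside p j x -> nboundary k p x by exists j.
have chord j : (j < k)%N -> hit j -> exists tu : K * K,
    [/\ 0 < tu.1 < 1, 0 < tu.2 < 1, nside p j (g tu.1 0) & nside p j (g 0 tu.2)].
  move=> jk [x sx tx].
  have [||||//|//|t [u [t01 u01 st su]]] := @segment_chord _ l m g (p j) (p j.+1) x fr.
  - by apply: vert'; apply: ltnW.
  - by apply: vert'.
  - by move=> y sy ty e; have [_] := base y ty e; apply; apply: side_bnd sy.
  - by move=> sq; apply: nq; apply: bC; apply: side_bnd sq.
  - by exists (t, u).
have [tu tuP] : exists tu : nat -> K * K, forall j, (j < k)%N -> hit j ->
    [/\ 0 < (tu j).1 < 1, 0 < (tu j).2 < 1, nside p j (g (tu j).1 0) & nside p j (g 0 (tu j).2)].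
  suff /choice[tu H] : forall j, exists w : K * K, (j < k)%N -> hit j ->
      [/\ 0 < w.1 < 1, 0 < w.2 < 1, nside p j (g w.1 0) & nside p j (g 0 w.2)] by exists tu.
  move=> j.
  have [[jk hj]|n] := pselect ((j < k)%N /\ hit j); last by exists 0 => jk hj; case: n.
  by have [w Hw] := chord j jk hj; exists w.
(* The cone edge from the apex to [g 1 0] starts outside [C] and ends in the interior, so some side
   crosses it. *)
have [j0 j0k hj0] : exists2 j, (j < k)%N & hit j.
  apply: contrapT => no.
  have sub : segment (g 0 0) (g 1 0) `<=` ~` C.
    apply: (connected_sub_open (@segment_connected2 _ _ _) (closed_openC cC) oU).
    - move=> x sx; have [Cx|] := pselect (C x); last by left.
      right; split => // -[j jk xj]; apply: no; exists j => //; exists x => //.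
      move/(frame_segment _ _ _ fr): sx => [r r01 []]; rewrite !LG !MG /in_triangle => -> ->.
      by split; lra.
    - by move=> x _ nC [].
    - by exists (g 0 0); split => //; apply: segmentl.
  have := sub _ (segmentr _ _); apply.
  have [] // : ninterior k p C (g 1 0).
  by apply: base; rewrite /in_triangle ?LG ?MG ?addr0 ?ler01 ?lexx.
have [i0 [i0k hi0] imin] := exists_min_nat (fun j => (tu j).1) (ex_intro2 _ _ j0 j0k hj0).
have [] := tuP i0 i0k hi0; set t := (tu i0).1; set u := (tu i0).2 => t01 u01 st su.
have [t0 t1] := andP t01; have [u0 u1] := andP u01.
have tn : t != 0 by apply: lt0r_neq0.
have un : u != 0 by apply: lt0r_neq0.
have no_common i j x : (i < k)%N -> (j < k)%N -> i <> j -> nside p i x -> nside p j x ->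
    in_triangle l m x -> False.
  move=> ik jk ij xi xj tx; have [v vk xE] := side_inter_vertex sp ik jk ij xi xj.
  by apply: (vert v vk); rewrite -xE.
have further j : (j < k)%N -> hit j -> j <> i0 -> t < (tu j).1 /\ u < (tu j).2.
  move=> jk hj ji; have [t01' u01' st' su'] := tuP j jk hj.
  have lt : t < (tu j).1.
    rewrite lt_neqAle imin // andbT; apply/eqP => e.
    apply: (no_common j i0 (g t 0)) => //; first by rewrite e.
    by rewrite /in_triangle LG MG addr0; split; lra.
  split=> //; rewrite ltNge; apply/negP => le.
  have [x tx [x1 x2]] := @chords_cross _ l m g t u (tu j).1 (tu j).2 fr t0 ltac:(lra) ltac:(lra) le u1.
  apply: (no_common i0 j x) => //; first by move=> e; apply: ji.
    exact: (segment_convex st su).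
  exact: (segment_convex st' su').
have : small (fun e => (e * t < 1 - t /\ e * u < 1 - u) /\
    forall j, (j < k)%N -> hit j -> j <> i0 -> e * t < (tu j).1 - t /\ e * u < (tu j).2 - u).
  apply: smallI; first by apply: smallI; apply: small_mul_lt; lra.
  apply: small_nat => j jk; have [[hj ji]|n] := pselect (hit j /\ j <> i0); last first.
    by exists 1 => // e _ hj ji; case: n.
  have [lt lu] := further j jk hj ji.
  have : small (fun e => e * t < (tu j).1 - t /\ e * u < (tu j).2 - u).
    by apply: smallI; apply: small_mul_lt; lra.
  by apply: smallW.
move=> /small_ex[eta eta0 [[et eu] etaP]].
have line x : 0 <= l x -> 0 <= m x -> l x / t + m x / u <= 1 + eta ->
    nboundary k p x -> l x / t + m x / u = 1.
  move=> lx mx lm [j jk xj].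
  have tx : in_triangle l m x by split => //; apply: chord_below_base et eu lm.
  have [ji|/eqP ji] := eqVneq j i0.
    by apply: (segment_chord_line fr t0 u0 st su); rewrite -ji.
  have hj : hit j by exists x.
  have [t01' u01' st' su'] := tuP j jk hj; have [h1 h2] := etaP j jk hj ji.
  have [t0' _] := andP t01'; have [u0' _] := andP u01'.
  have E := segment_chord_line fr t0' u0' st' su' xj.
  by have := farther_chord lx mx t0 u0 t0' u0' h1 h2 E; rewrite ltNge lm.
(* A point beyond the chord would be joined to the apex by a segment that crosses the chord,
   although this segment avoids [C]. *)
have bP' c : c \in [:: b; b'] -> [/\ 0 < l c, 0 < m c & l c / t + m c / u <= 1].
  move=> /bP[lc mc sc]; split => //; rewrite leNgt; apply/negP => gt.
  have [y ys yc] := ray_meets_chord fr t0 u0 lc mc gt.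
  apply: (sc _ ys); apply: bC; apply: (side_bnd i0) => //; exact: (segment_convex st su).
(* No vertex lies in the cone, so the ends of the chord are strictly inside the side. *)
have ends s : 0 <= s <= 1 -> in_triangle l m (nalong p i0 s) -> 0 < s < 1.
  move=> /andP[s0 s1] ts; rewrite !lt_neqAle.
  rewrite s0 s1 !andbT; apply/andP; split; apply/eqP => e.
    by apply: (vert' i0); [exact: ltnW|move: ts; rewrite -e /nalong !mul0r !addr0 -surjective_pairing].
  apply: (vert' i0.+1) => //; move: ts; rewrite e /nalong.
  suff -> : ((p i0).1 + 1 * ((p i0.+1).1 - (p i0).1),
    (p i0).2 + 1 * ((p i0.+1).2 - (p i0).2)) = p i0.+1 by [].
  by case: (p i0.+1) => ? ? /=; congr pair; ring.
move/segmentP: (st) => [s1 s101 e1]; rewrite -/(nalong p i0 s1) in e1.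
move/segmentP: (su) => [s2 s201 e2]; rewrite -/(nalong p i0 s2) in e2.
have s1' : 0 < s1 < 1 by apply: ends => //; rewrite -e1 /in_triangle LG MG; split; lra.
have s2' : 0 < s2 < 1 by apply: ends => //; rewrite -e2 /in_triangle LG MG; split; lra.
have s12 : s1 != s2.
  apply/eqP => h; have : l (g t 0) = l (g 0 u) by rewrite e1 e2 h.
  by rewrite !LG => e; rewrite e eqxx in tn.
have [s10 s11] := andP s1'; have [s20 s21] := andP s2'.
clear base vert vert' tuP no_common further etaP s101 s201 s1' s2' imin chord ends.
(* The side may traverse the cone in either direction; the second case exchanges the two
   coordinates. *)
case/orP: (lt_total s12) => h.
- by apply: (@attach_cone_oriented k p C l m g b b' i0 t u s1 s2 eta).
- have [||p' [C' [h1 h2 h3 h4 h5]]] := @attach_cone_oriented k p C m l (fun a b => g b a) b b' i0 u t s2 s1 eta gd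
    (frameC fr) nq i0k u01 t01 eta0 s20 h s11 (esym e2) (esym e1).
  + by move=> x mx lx; rewrite addrC; apply: line.
  + by move=> c /bP'[]; rewrite addrC; split.
  exists p', C'; split => // x /h3[]; first by left.
  by move=> [m0 l0 ml]; right; split => //; lra.
Qed.

End AttachCone.

(** * Enclosing two more points by one thin spike *)

Section Pair.
Variable K : realType.
Implicit Types (p : nat -> K * K) (x y z q w : K * K) (s t : K)
  (C U : set (K * K)) (l m : K * K -> K) (g : K -> K -> K * K).

Lemma frame_id : frame (fun x : K * K => x.1) (fun x => x.2) (fun a b => (a, b)).
Proof.
split=> //; try by case.
- by exists 1, 0, 0 => x; ring.
- by exists 0, 1, 0 => x; ring.
- by exists (0, 0), (1, 0), (0, 1) => a b /=; congr pair; ring.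
Qed.

(** Change to the origin [(a0, b0)] and the basis [(a1, b1)], [(a2, b2)]; the new coordinates come
    from Cramer's rule. *)
Lemma frame_reparam l m g (a0 a1 a2 b0 b1 b2 : K) : a1 * b2 - a2 * b1 != 0 ->
  frame l m g ->
  frame (fun x => ((l x - a0) * b2 - (m x - b0) * a2) / (a1 * b2 - a2 * b1))
    (fun x => (a1 * (m x - b0) - b1 * (l x - a0)) / (a1 * b2 - a2 * b1))
    (fun a b => g (a0 + a * a1 + b * a2) (b0 + a * b1 + b * b2)).
Proof.
move=> D [[la [lb [lc lE]]] [ma [mb [mc mE]]] glm gK [z [u [v gE]]]]; split.
- exists ((la * b2 - ma * a2) / (a1 * b2 - a2 * b1)), ((lb * b2 - mb * a2) / (a1 * b2 - a2 * b1)),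
    (((lc - a0) * b2 - (mc - b0) * a2) / (a1 * b2 - a2 * b1)) => x.
  by rewrite lE mE; field.
- exists ((a1 * ma - b1 * la) / (a1 * b2 - a2 * b1)), ((a1 * mb - b1 * lb) / (a1 * b2 - a2 * b1)),
    ((a1 * (mc - b0) - b1 * (lc - a0)) / (a1 * b2 - a2 * b1)) => x.
  by rewrite lE mE; field.
- by move=> a b; have [-> ->] := glm (a0 + a * a1 + b * a2) (b0 + a * b1 + b * b2); split; field.
- by move=> x; rewrite -[RHS]gK; congr g; field.
- exists (z.1 + a0 * u.1 + b0 * v.1, z.2 + a0 * u.2 + b0 * v.2),
    (a1 * u.1 + b1 * v.1, a1 * u.2 + b1 * v.2), (a2 * u.1 + b2 * v.1, a2 * u.2 + b2 * v.2) => a b.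
  by rewrite gE /=; congr pair; ring.
Qed.

Lemma affine_frame l m g (h : K * K -> K) x : frame l m g -> affine h ->
  h x = h (g 0 0) + l x * (h (g 1 0) - h (g 0 0)) + m x * (h (g 0 1) - h (g 0 0)).
Proof.
move=> [_ _ _ gK [z [u [v gE]]]] [a [b [c hE]]].
by rewrite -{1}(gK x) !hE !gE /=; ring.
Qed.

Lemma affine_le_triangle l m g (h : K * K -> K) (M : K) x : frame l m g -> affine h ->
  h (g 0 0) < M -> h (g 1 0) < M -> h (g 0 1) < M -> in_triangle l m x -> h x < M.
Proof.
move=> fr ah h0 h1 h2 [l0 m0 lm]; rewrite (affine_frame x fr ah).
have q1 : 0 <= l x * (M - h (g 1 0)) by apply: mulr_ge0; lra.
have q2 : 0 <= m x * (M - h (g 0 1)) by apply: mulr_ge0; lra.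
have q0 : 0 <= (1 - l x - m x) * (M - h (g 0 0)) by apply: mulr_ge0; lra.
have [e|e] := ltP (l x + m x) 1.
  have : 0 < (1 - l x - m x) * (M - h (g 0 0)) by apply: mulr_gt0; lra.
  nra.
have [e'|e'] := ltP 0 (l x).
  have : 0 < l x * (M - h (g 1 0)) by apply: mulr_gt0; lra.
  nra.
have : 0 < m x * (M - h (g 0 1)) by apply: mulr_gt0; lra.
nra.
Qed.

Lemma open_line U z (v : K * K) : open U -> U z ->
  small (fun e => forall t, `|t| <= e -> U (z.1 + t * v.1, z.2 + t * v.2)).
Proof.
move=> oU Uz; pose f t := (z.1 + t * v.1, z.2 + t * v.2).
have f0 : f 0 = z by rewrite /f !mul0r !addr0 -surjective_pairing.
have fc : {for 0, continuous f}.
  by apply: (@cvg_pair _ _ _ _ (nbhs (f 0).1) (nbhs (f 0).2)); apply: cvgD; try exact: cvg_cst; apply: cvgM; [exact: cvg_id|exact: cvg_cst|exact: cvg_id|exact: cvg_cst].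
have : \forall t \near (0 : K), U (f t).
  by apply: fc; rewrite f0; apply: open_nbhs_nbhs.
move=> /nbhs_ballP[e /= e0 He]; exists (e / 2); first by lra.
move=> e' e'e t te; apply: He; rewrite /ball /= sub0r normrN; lra.
Qed.

(** The quantity bounded is the signed distance to the axis of the spike, up to scale: once [A] and
    [B] are fixed, [e] alone controls the thickness. *)
Lemma spike_height_le (a b A B e : K) : 0 <= a -> 0 <= b -> a + b <= 1 ->
  0 < A -> 0 < B -> 0 < e -> `|e * (1 - a * A - b * B)| <= e * (1 + A + B).
Proof.
move=> a0 b0 ab A0 B0 e0; rewrite normrM gtr0_norm // ler_pM2l // ler_norml.
have ? : 0 <= a * A by apply: mulr_ge0; lra.
have ? : 0 <= (1 - a) * A by apply: mulr_ge0; lra.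
have ? : 0 <= b * B by apply: mulr_ge0; lra.
have ? : 0 <= (1 - b) * B by apply: mulr_ge0; lra.
by apply/andP; split; lra.
Qed.

(** On the axis, [a + b] is [1 / B] at the abscissa [- tau / 2] and [1 / A] at [1 + kap]. For [s] in
    [[0, 1]] it is strictly between them, and comparison with [a * A + b * B = 1] gives both
    signs. *)
Lemma spike_axis_gt0 (S tau kap A B s a b : K) : 0 < tau -> 0 < kap -> A < B ->
  A * (1 + kap + tau) = S + tau -> B * (tau / 2) = S + tau -> 0 <= s <= 1 ->
  (a + b) * (S + tau) = s + tau -> a * A + b * B = 1 -> 0 < a /\ 0 < b.
Proof.
move=> tau0 kap0 AB AE BE s01 E1 E2.
have AB' : 0 < B - A by lra.
have tau2 : 0 < tau / 2 by lra.
have kt : 0 < 1 + kap + tau by lra.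
have E3 : (a + b) * B * (tau / 2) = s + tau by rewrite -mulrA BE.
have E4 : (a + b) * A * (1 + kap + tau) = s + tau by rewrite -mulrA AE.
have q1 : 0 < ((a + b) * B - 1) * (tau / 2) by rewrite mulrBl E3; lra.
have q2 : 0 < (1 - (a + b) * A) * (1 + kap + tau) by rewrite mulrBl E4; lra.
rewrite (pmulr_lgt0 _ tau2) in q1; rewrite (pmulr_lgt0 _ kt) in q2.
by rewrite -(pmulr_lgt0 a AB') -(pmulr_lgt0 b AB'); split; lra.
Qed.

(* In coordinates [sc], [oc] where [b'] and [b] are [(0, 0)] and [(1, 0)], the
   spike is the triangle with apex [(- tau, e)] whose two edges cross the axis at
   [- tau / 2] and [1 + kap], truncated at the abscissa [S] of [z].  Choosing
   [kap] first and then [e] keeps it off the vertices of [p], including those on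
   the line through [b] and [b'], which have abscissa larger than [1 + kap]. *)
Lemma attach_pair k p C (h : K * K -> K) (M S : K) (b b' z : K * K) (Rs : seq (K * K)) :
  good k p C -> affine h -> (forall x, C x -> h x < h b) -> h b < h b' -> h b' < M ->
  ninterior k p C z -> z = (b'.1 + S * (b.1 - b'.1), b'.2 + S * (b.2 - b'.2)) ->
  (forall r, r \in Rs -> ~ C r /\
    (b.1 - b'.1) * (r.2 - b'.2) - (b.2 - b'.2) * (r.1 - b'.1) <> 0) ->
  exists p' C', [/\ good (k + 3) p' C',
    ninterior k p C `<=` ninterior (k + 3) p' C',
    ninterior (k + 3) p' C' b /\ ninterior (k + 3) p' C' b',
    forall r, r \in Rs -> ~ C' r & forall x, C' x -> h x < M].
Proof.
move=> gd ah hC hb hM zU zE RsP; have [sp _ oU _ _] := gd; have [k3 pk _ _] := sp.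
pose e1 := b.1 - b'.1; pose e2 := b.2 - b'.2.
have N0 : 0 < e1 * e1 + e2 * e2.
  rewrite lt_neqAle eq_sym paddr_eq0 ?mulf_eq0 ?orbb -?expr2 ?sqr_ge0 // addr_ge0 ?sqr_ge0 // andbT.
  apply/negP => /andP[/eqP E1 /eqP E2].
  have : b = b' by rewrite [b]surjective_pairing [b']surjective_pairing; congr pair; rewrite /e1 /e2 in E1 E2; lra.
  by move=> bb; rewrite bb ltxx in hb.
have N0' : e1 * e1 - - e2 * e2 != 0 by apply: lt0r_neq0; lra.
(* The second basis vector is [b - b'] turned by a right angle: [sc] runs along the line through
   [b'] and [b], and [oc] measures the offset from it. *)
have fr0 := frame_reparam b'.1 b'.2 N0' frame_id.
move: fr0; set sc := (fun x : K * K => ((x.1 - b'.1) * e1 - (x.2 - b'.2) * - e2) / (e1 * e1 - - e2 * e2)).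
set oc := (fun x : K * K => (e1 * (x.2 - b'.2) - e2 * (x.1 - b'.1)) / (e1 * e1 - - e2 * e2)).
set g0 := (fun a c : K => _) => fr0; have [_ _ slm g0K _] := fr0.
have SG a c : sc (g0 a c) = a by case: (slm a c).
have OG a c : oc (g0 a c) = c by case: (slm a c).
have gb' : g0 0 0 = b' by rewrite /g0 !mul0r !addr0 -surjective_pairing.
have gb : g0 1 0 = b by rewrite /g0 [b]surjective_pairing /e1 /e2 /=; congr pair; ring.
have gz : g0 S 0 = z by rewrite zE /g0 /e1 /e2; congr pair; ring.
have [sb ob] : sc b = 1 /\ oc b = 0 by rewrite -gb SG OG.
have [sb' ob'] : sc b' = 0 /\ oc b' = 0 by rewrite -gb' SG OG.
pose n := h (g0 0 1) - h b'.
have hE x : h x = h b' - sc x * (h b' - h b) + oc x * n.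
  by rewrite (affine_frame x fr0 ah) gb' gb /n; ring.
have S1 : 1 < S.
  have : h z < h b by apply: hC; case: zU.
  rewrite hE -gz SG OG mul0r addr0 => hz; rewrite ltNge; apply/negP => S1.
  have : 0 <= (1 - S) * (h b' - h b) by apply: mulr_ge0; lra.
  lra.
(* Going beyond [b'] by [tau] raises [h] by [tau * (h b' - h b)], which must stay under the level
   [M]. *)
have /small_ex[tau tau0 htau] := @small_mul_lt _ (h b' - h b) (M - h b') ltac:(lra).
have : small (fun e => forall j, (j < k)%N -> oc (p j) = 0 -> e < sc (p j) - 1).
  apply: small_nat => j jk; have [e|ne] := pselect (oc (p j) = 0); last by exists 1.
  have sj : 1 < sc (p j).
    have : h (p j) < h b.
      by apply: hC; have [_ [bC _ _] _ _ _] := gd; apply: bC; exists j => //; apply: segmentl.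
    rewrite hE e mul0r addr0 => hz; rewrite ltNge; apply/negP => S1'.
    have : 0 <= (1 - sc (p j)) * (h b' - h b) by apply: mulr_ge0; lra.
    lra.
  have : small (fun e => e < sc (p j) - 1) by apply: small_lt; lra.
  exact: smallW.
move=> /small_ex[kap kap0 kapP].
pose A := (S + tau) / (1 + kap + tau); pose B := (S + tau) / (tau / 2).
have A0 : 0 < A by apply: divr_gt0; lra.
have B0 : 0 < B by apply: divr_gt0; lra.
have dn1 : 1 + kap + tau != 0 by apply: lt0r_neq0; lra.
have dn2 : tau != 0 by apply: lt0r_neq0; lra.
have AE : A * (1 + kap + tau) = S + tau by rewrite /A; field.
have BE : B * (tau / 2) = S + tau by rewrite /B; field.
have AB : A < B.
  have : 0 < A * (1 + kap + tau / 2) by apply: mulr_gt0; lra.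
  move=> q; rewrite -(ltr_pM2r (_ : 0 < tau / 2)); lra.
have zU0 : ninterior k p C (g0 S 0) by rewrite gz.
have := open_line (- e2, e1) oU zU0.
move=> /small_ex[rho rho0 rhoP].
have AB0 : 0 < 1 + A + B by lra.
(* In order: the base of the spike stays in the interior around [z], the apex has a level strictly
   between [h b'] and [M], and the vertices off the axis and the points of [Rs] stay outside the
   spike. *)
have : small (fun e => ((e * (1 + A + B) < rho /\
     (e * n < M - h b' - tau * (h b' - h b) /\ e * - n < tau * (h b' - h b))) /\
     (forall j, (j < k)%N -> oc (p j) <> 0 -> e * (1 + A + B) < `|oc (p j)|)) /\
     (forall r, r \in Rs -> e * (1 + A + B) < `|oc r|)).
  apply: smallI; first apply: smallI; first apply: smallI.
  - exact: small_mul_lt.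
  - by apply: smallI; apply: small_mul_lt; [lra|apply: mulr_gt0; lra].
  - apply: small_nat => j jk; have [e|ne] := pselect (oc (p j) = 0); first by exists 1.
    have : small (fun e => e * (1 + A + B) < `|oc (p j)|).
      by apply: small_mul_lt; rewrite normr_gt0; apply/eqP.
    exact: smallW.
  - apply: small_all => r rR; apply: small_mul_lt; rewrite normr_gt0 /oc mulf_neq0 ?invr_neq0 //.
    by apply/eqP; case: (RsP r rR).
move=> /small_ex[e e0 [[[erho [en1 en2]] ev] er]].
have D : (S + tau) * (- e * B) - (S + tau) * (- e * A) != 0.
  have : 0 < (S + tau) * e * (B - A) by apply: mulr_gt0; [apply: mulr_gt0|]; lra.
  by move=> q; apply: ltr0_neq0; lra.
(* The frame of the spike: apex [(- tau, e)] and edge vectors [(S + tau, - e * A)] and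
   [(S + tau, - e * B)]. *)
have [l [m [g [fr scE ocE]]]] : exists l m g, [/\ frame l m g,
    forall x, sc x = - tau + (l x + m x) * (S + tau) &
    forall x, oc x = e * (1 - l x * A - m x * B)].
  have fr := frame_reparam (- tau) e D fr0; have [_ _ _ gK _] := fr.
  do 3 eexists; split; first exact: fr.
    by move=> x; rewrite -{1}(gK x) SG; ring.
  by move=> x; rewrite -{1}(gK x) OG; ring.
have g0E c : g0 S c = ((g0 S 0).1 + c * - e2, (g0 S 0).2 + c * e1).
  by rewrite /g0 /=; congr pair; ring.
have [_ _ glm _ _] := fr.
have LG a c : l (g a c) = a by case: (glm a c).
have MG a c : m (g a c) = c by case: (glm a c).
clearbody A B n; clear D fr0 N0 N0'; clearbody sc oc g0; clear zE; clearbody e1 e2.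
have oc_le x : in_triangle l m x -> `|oc x| <= e * (1 + A + B).
  by move=> [l0 m0 lm]; rewrite ocE; apply: spike_height_le.
have hg00 : h b' < h (g 0 0) < M.
  rewrite (hE (g 0 0)) scE ocE LG MG addr0 !mul0r addr0 !subr0 mulr1; apply/andP; split; lra.
have baseP x : in_triangle l m x -> l x + m x = 1 -> ninterior k p C x.
  move=> tx lm1; rewrite -(g0K x) scE lm1.
  rewrite (_ : - tau + 1 * (S + tau) = S); last by ring.
  rewrite g0E.
  by apply: rhoP; apply: le_trans (oc_le _ tx) (ltW erho).
have [||c|p' [C' [gd' CC' C'C sub bin]]] := @attach_cone _ k p C l m g b b' gd fr _ baseP.
- by move=> /hC; lra.
- move=> j jk tx; have [zo|zo] := pselect (oc (p j) = 0); last first.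
    by have := oc_le _ tx; rewrite leNgt (ev j jk zo).
  have := kapP j jk zo; case: tx => l0 m0 lm.
  move: zo; rewrite ocE => /eqP; rewrite mulf_eq0 gt_eqF //= => /eqP zo.
  have ? : 0 <= m (p j) * (B - A) by apply: mulr_ge0; lra.
  have le1 : (l (p j) + m (p j)) * A <= 1 by lra.
  have : (l (p j) + m (p j)) * A * (1 + kap + tau) <= 1 * (1 + kap + tau).
    by rewrite ler_pM2r //; lra.
  by rewrite -mulrA AE scE; lra.
- move=> cb.
  have [sc01 oc0] : 0 <= sc c <= 1 /\ oc c = 0.
    by move: cb; rewrite !inE => /orP[] /eqP ->; rewrite ?sb ?sb' ?ob ?ob' ?lexx ?ler01.
  have hc : h b <= h c by move: cb; rewrite !inE => /orP[] /eqP ->; lra.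
  have E2 : l c * A + m c * B = 1.
    move: oc0; rewrite ocE => /eqP; rewrite mulf_eq0 gt_eqF //= => /eqP E.
    by clear -E; lra.
  have E3 : (l c + m c) * (S + tau) = sc c + tau by rewrite scE; ring.
  have [q1 q2] := spike_axis_gt0 tau0 kap0 AB AE BE sc01 E3 E2; split => //.
  (* At both ends of the segment from the apex to [c] the level is at least [h b], while [C] lies
     strictly below it. *)
  have hbg : h b <= h (g 0 0) by lra.
  clear -ah hC hc hbg.
  move=> x /segmentP[t /andP[t0 t1] ->] /hC; rewrite affine_segment //.
  have ? : 0 <= t * (h c - h b) by apply: mulr_ge0; lra.
  have ? : 0 <= (1 - t) * (h (g 0 0) - h b) by apply: mulr_ge0; lra.
  lra.
have tri10 : in_triangle l m (g 1 0) by rewrite /in_triangle LG MG addr0 ler01 lexx.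
have tri01 : in_triangle l m (g 0 1) by rewrite /in_triangle LG MG add0r ler01 lexx.
exists p', C'; split => //.
- by split; apply: bin; rewrite !inE eqxx ?orbT.
- move=> r rR /C'C[|tr]; first by case: (RsP r rR).
  by have := oc_le _ tr; rewrite leNgt (er r rR).
- move=> x /C'C[/hC|]; first by lra.
  apply: (affine_le_triangle fr ah); first by lra.
    have : C (g 1 0) by case: (baseP _ tri10); rewrite ?LG ?MG ?addr0.
    by move=> /hC; lra.
  have : C (g 0 1) by case: (baseP _ tri01); rewrite ?LG ?MG ?add0r.
  by move=> /hC; lra.
Qed.

End Pair.

(** * A triangle as initial region *)

Section Base.
Variable K : realType.
Implicit Types (p : nat -> K * K) (x y z q w : K * K) (s t : K)
  (C U : set (K * K)) (l m : K * K -> K) (g : K -> K -> K * K).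

Lemma triangle_good l m g : frame l m g ->
  exists2 p, good 3 p [set x | in_triangle l m x] &
    forall x, 0 < l x -> 0 < m x -> l x + m x < 1 ->
      ninterior 3 p [set x | in_triangle l m x] x.
Proof.
move=> fr; have [al am glm gK _] := fr.
have aff0 c := @affine_cst K c; have alm := affineD al am.
have LG a c : l (g a c) = a by case: (glm a c).
have MG a c : m (g a c) = c by case: (glm a c).
pose p i := if i == 1%N then g 1 0 else if i == 2%N then g 0 1 else g 0 0.
have s0 x : nside p 0 x <-> in_triangle l m x /\ m x = 0.
  rewrite /nside /p /=; split=> [/(frame_segment _ _ _ fr)[t t01]|[[l0 m0 lm] mx]].
    by rewrite /in_triangle !LG !MG => -[-> ->]; split; [split|]; lra.
  by apply/(frame_segment _ _ _ fr); exists (l x); rewrite ?LG ?MG; lra.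
have s1 x : nside p 1 x <-> in_triangle l m x /\ l x + m x = 1.
  rewrite /nside /p /=; split=> [/(frame_segment _ _ _ fr)[t t01]|[[l0 m0 lm] mx]].
    by rewrite /in_triangle !LG !MG => -[-> ->]; split; [split|]; lra.
  by apply/(frame_segment _ _ _ fr); exists (m x); rewrite ?LG ?MG; lra.
have s2 x : nside p 2 x <-> in_triangle l m x /\ l x = 0.
  rewrite /nside /p /=; split=> [/(frame_segment _ _ _ fr)[t t01]|[[l0 m0 lm] mx]].
    by rewrite /in_triangle !LG !MG => -[-> ->]; split; [split|]; lra.
  by apply/(frame_segment _ _ _ fr); exists (1 - m x); rewrite ?LG ?MG; lra.
set C := [set x | _].
have bndP x : nboundary 3 p x <-> in_triangle l m x /\ [\/ m x = 0, l x + m x = 1 | l x = 0].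
  split.
    move=> [[|[|[|//]]] _ /=] => [/s0|/s1|/s2] [tx e]; split => //; by [constructor 1|constructor 2|constructor 3].
  by move=> [tx [e|e|e]]; [exists 0%N => //; apply/s0|exists 1%N => //; apply/s1|exists 2%N => //; apply/s2].
have intE : ninterior 3 p C = [set x | 0 < l x] `&` [set x | 0 < m x] `&` [set x | l x + m x < 1].
  apply/seteqP; split=> x.
    move=> [tx nb]; have [l0 m0 lm] := tx; split; [split|] => /=; rewrite lt_neqAle ?l0 ?m0 ?lm andbT;
      apply/eqP => e; apply: nb; apply/bndP; split => //.
    + by constructor 3.
    + by constructor 1.
    + by constructor 2.
  move=> [[/= l0 m0] lm]; split; first by split; lra.
  by move=> /bndP[_ [e|e|e]]; lra.
have CE : C = [set x | 0 <= l x] `&` [set x | 0 <= m x] `&` [set x | l x + m x <= 1].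
  by apply/seteqP; split=> x /=; [case|case; case].
have c3 i j : (i < j < 3)%N -> [\/ i = 0%N /\ j = 1%N, i = 0%N /\ j = 2%N | i = 1%N /\ j = 2%N].
  move=> ij; have [h|[h|h]] : (i = 0 /\ j = 1)%N \/ (i = 0 /\ j = 2)%N \/ (i = 1 /\ j = 2)%N by lia.
  - by constructor 1.
  - by constructor 2.
  - by constructor 3.
exists p; last by move=> x l0 m0 lm; rewrite intE.
split.
- split=> //.
    have D (a b c d : K) : g a b = g c d -> a = c /\ b = d.
      by move=> e; have := congr1 l e; have := congr1 m e; rewrite !LG !MG.
    by move=> i j /c3[] [-> ->]; rewrite /p /= => /D[] a b; clear -a b; lra.
  move=> i j x /c3[] [-> ->].
  + move=> /s0[_ e] /s1[_ e']; left; split => //; apply: (frame_inj fr); rewrite ?LG ?MG; lra.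
  + move=> /s0[_ e] /s2[_ e']; right; split => //; apply: (frame_inj fr); rewrite ?LG ?MG; lra.
  + move=> /s1[_ e] /s2[_ e']; left; split => //; apply: (frame_inj fr); rewrite ?LG ?MG; lra.
- split; first by move=> x /bndP[].
    by rewrite CE; apply: closedI; [apply: closedI|]; apply: closed_affine_le.
  exact: frame_triangle_bounded fr.
- by rewrite intE; apply: openI; [apply: openI|]; apply: open_affine_lt.
- move=> x /bndP[[l0 m0 lm] _]; rewrite intE.
  apply: (@closure_convexcomb _ _ x (g (1 / 3) (1 / 3))) => t /andP[t0 t1].
  have ? : 0 <= (1 - t) * l x by apply: mulr_ge0; lra.
  have ? : 0 <= (1 - t) * m x by apply: mulr_ge0; lra.
  have ? : 0 <= (1 - t) * (1 - (l x + m x)) by apply: mulr_ge0; lra.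
  by split; [split|] => /=; rewrite !affine_segment // ?LG ?MG; lra.
(* Three open half-planes, each convex and overlapping another, have a connected union. *)
- have -> : ~` C = ([set x | l x < 0] `|` [set x | m x < 0]) `|` [set x | 1 < l x + m x].
    apply/seteqP; split=> x /=.
      move=> nC; have [h|h] := ltP (l x) 0; first by left; left.
      have [h'|h'] := ltP (m x) 0; first by left; right.
      by right; rewrite ltNge; apply/negP => h''; apply: nC.
    by move=> [[h|h]|h] [l0 m0 lm]; clear -h l0 m0 lm; lra.
  apply: connectedU; last 2 first.
  + apply: connectedU; last 2 first.
    * by apply: convex_connected; apply: convex_affine_lt.
    * by apply: convex_connected; apply: convex_affine_lt.
    * by exists (g (-1) (-1)); split => /=; rewrite ?LG ?MG; lra.
  + by apply: convex_connected; apply: convex_affine_lt.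
  + by exists (g (-1) 3); split; [left|] => /=; rewrite ?LG ?MG; lra.
Qed.

End Base.

(** * The upper bound: hull edge, slab, initial triangle and iteration over the pairs *)

Section Upper.
Variable K : realType.
Implicit Types (p : nat -> K * K) (x y z q w b r : K * K) (t : K)
  (C U : set (K * K)) (l m h : K * K -> K) (g : K -> K -> K * K) (B R : seq (K * K)).

(** The component of an interior point cannot leave the interior, so it is bounded with [C]. The
    connected complement of [C] lies in a single component; were that bounded, its union with [C]
    would make the whole plane bounded. *)
Lemma good_polygon k p C : good k p C ->
  let P := fun i : 'I_k => p i in [/\ simple_polygon P,
    ninterior k p C `<=` polygon_interior P & ~` C `<=` polygon_exterior P].
Proof.
move=> [[k3 pk inj sim] [bC cC bdC] oU _ cV] P.
have PS (i : 'I_k) : P (ordS i) = p i.+1.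
  rewrite /P /=; have [e|ne] := eqVneq i.+1 k; first by rewrite e modnn pk.
  by rewrite modn_small //; have := ltn_ord i; lia.
have sideE (i : 'I_k) : side P i = nside p i by rewrite /side PS.
have bE : polygon_boundary P = nboundary k p.
  apply/seteqP; split=> x.
    by move=> [i _]; rewrite sideE; exists i.
  by move=> [i ik xi]; exists (Ordinal ik) => //; rewrite sideE.
split.
- split=> //.
  + move=> i j e; apply/val_inj; apply: contrapT => ne.
    have [h|h] : (i < j)%N \/ (j < i)%N by simpl in ne; lia.
      by apply: (inj i j) => //; rewrite h ltn_ord.
    by apply: (inj j i) => //; rewrite h ltn_ord.
  + move=> i; rewrite !sideE PS; apply/seteqP; split=> x /=; last first.
      by move=> ->; split; [exact: segmentr|rewrite /nside -PS; exact: segmentl].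
    have ik := ltn_ord i; have [e|ne] := eqVneq i.+1 k.
      have -> : (i.+1 %% k = 0)%N by rewrite e modnn.
      move=> [xi x0]; have [[e' _]|[_ _ ->]] := sim 0%N i x ltac:(lia) x0 xi; first by lia.
      by rewrite e pk.
    have -> : (i.+1 %% k = i.+1)%N by rewrite modn_small //; lia.
    by move=> [xi x0]; have [[_ ->]|[e1 e2 _]] := sim i i.+1 x ltac:(lia) xi x0; last by lia.
  + have W (i j : 'I_k) x : (i < j)%N -> j != ordS i -> i != ordS j ->
        nside p i x -> nside p j x -> False.
      move=> ij nj ni xi xj; have jk := ltn_ord j.
      have [[e _]|[e1 e2 _]] := sim i j x ltac:(lia) xi xj.
        by move/eqP: nj; apply; apply/val_inj; rewrite /= e modn_small //; lia.
      by move/eqP: ni; apply; apply/val_inj; rewrite /= e2 modnn.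
    move=> i j ij nj ni; rewrite !sideE; apply/seteqP; split=> x //= [xi xj].
    have ne : nat_of_ord i <> j by move=> e; move/eqP: ij; apply; apply/val_inj.
    have [h|h] : (i < j)%N \/ (j < i)%N by lia.
      exact: (W i j x).
    exact: (W j i x).
- move=> x xU; split; first by rewrite bE; case: xU.
  have sub : connected_component (~` polygon_boundary P) x `<=` ninterior k p C.
    apply: (connected_sub_open (@component_connected _ _ _) oU (closed_openC cC)).
    + move=> y /connected_component_sub; rewrite bE => ny.
      by have [Cy|] := pselect (C y); [left|right].
    + by move=> y _ [].
    + exists x; split => //; apply: connected_component_refl; rewrite bE.
      by case: xU.
  have /bounded_setP[M HM] := bdC; apply/bounded_setP.
  by exists M => y /sub[Cy _]; apply: HM.
- move=> x nCx; split; first by rewrite bE => /bC.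
  move=> bd; apply: (@not_bounded_setT K).
  have -> : [set: K * K] = C `|` connected_component (~` polygon_boundary P) x.
    apply/seteqP; split=> // y _; have [Cy|nCy] := pselect (C y); [by left|right].
    apply: (connected_component_max nCx _ cV nCy).
    by move=> w nCw; rewrite bE => /bC.
  exact: bounded_setU2.
Qed.

Definition det x y z : K :=
  (y.1 - x.1) * (z.2 - x.2) - (y.2 - x.2) * (z.1 - x.1).

Lemma det_collinear (p q r : K * K) : p <> q -> det p q r = 0 -> collinear p q r.
Proof.
move=> pq d0; exists (- (q.2 - p.2)), (q.1 - p.1),
  (- (q.2 - p.2) * p.1 + (q.1 - p.1) * p.2); split.
  apply/eqP => -[e1 e2]; apply: pq.
  by rewrite [p]surjective_pairing [q]surjective_pairing; congr pair; lra.
by move: d0; rewrite /det => d0; split; lra.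
Qed.

Lemma attach_pairs h R : affine h -> forall j (s : seq (K * K)) k p C, size s = j.*2 ->
  good k p C -> pairwise (fun x y => h x < h y) s ->
  (forall x b, C x -> b \in s -> h x < h b) ->
  (forall b b', b \in s -> b' \in s -> h b < h b' -> exists2 S : K, True &
     ninterior k p C (b'.1 + S * (b.1 - b'.1), b'.2 + S * (b.2 - b'.2))) ->
  (forall r, r \in R -> ~ C r) ->
  (forall b b' r, b \in s -> b' \in s -> r \in R -> h b < h b' -> det b' b r <> 0) ->
  exists p' C', [/\ good (k + 3 * j) p' C',
    ninterior k p C `<=` ninterior (k + 3 * j) p' C',
    forall b, b \in s -> ninterior (k + 3 * j) p' C' b &
    forall r, r \in R -> ~ C' r].
Proof.
move=> ah; elim=> [|j IH] [|b [|b' s]] k p C //=.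
  by move=> _ gd _ _ _ RC _; exists p, C; rewrite muln0 addn0; split.
rewrite doubleS => -[sz] gd /andP[/andP[bb' bs]] /andP[b's srt] hC zP RC dP.
(* The level of the next point serves as ceiling for the spike, so that the new region stays below
   all later points. *)
have [M [hM Ms]] : exists M : K, h b' < M /\ forall c, c \in s -> M <= h c.
  case: s srt b's {bs sz hC zP dP} => [|c s] /=; first by exists (h b' + 1); split => //; lra.
  move=> /andP[cs _] /andP[hc _]; exists (h c); split => // d.
  by rewrite inE => /orP[/eqP -> //|ds]; apply: ltW; move/allP: cs; apply.
have bB : b \in b :: b' :: s by rewrite inE eqxx.
have b'B : b' \in b :: b' :: s by rewrite !inE eqxx orbT.
have sB c : c \in s -> c \in b :: b' :: s by move=> cs; rewrite !inE cs !orbT.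
have [S _ zU] := zP b b' bB b'B bb'.
have [||p1 [C1 [gd1 sub1 [b1 b1'] R1 h1]]] := @attach_pair _ k p C h M S b b' _ R gd ah _ bb' hM zU erefl.
- by move=> x Cx; apply: hC.
- by move=> r rR; split; [apply: RC|apply: (dP b b' r)].
have [||||p2 [C2 [gd2 sub2 b2 R2]]] := IH s (k + 3)%N p1 C1 sz gd1 srt.
- by move=> x c /h1 hx cs; apply: lt_le_trans hx (Ms c cs).
- move=> c c' cs c's cc'; have [S' _ h'] := zP c c' (sB _ cs) (sB _ c's) cc'.
  by exists S' => //; apply: sub1.
- exact: R1.
- by move=> c c' r cs c's; apply: dP; apply: sB.
exists p2, C2; rewrite mulnS addnA; split=> //.
- by move=> x /sub1/sub2.
- by move=> c; rewrite !inE => /orP[/eqP ->|/orP[/eqP ->|/b2 //]]; apply: sub2.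
Qed.

Lemma exists_min_seq (T : eqType) (f : T -> K) (s : seq T) : s != [::] ->
  exists2 a, a \in s & forall c, c \in s -> f a <= f c.
Proof.
elim: s => [//|a s IH] _; have [->|/IH[c cs Hc]] := eqVneq s [::].
  by exists a; rewrite ?inE // => c; rewrite inE => /eqP ->.
have [h|h] := leP (f a) (f c).
  exists a; first by rewrite inE eqxx.
  by move=> d; rewrite inE => /orP[/eqP ->|/Hc] //; apply: le_trans.
exists c; first by rewrite inE cs orbT.
by move=> d; rewrite inE => /orP[/eqP ->|/Hc] //; apply: ltW.
Qed.

(** Take [b1] leftmost. If another point has the same abscissa, the vertical line supports [B];
    otherwise take [b2] with the least slope from [b1]. General position excludes a third point on
    the line. *)
Lemma hull_edge B : (1 < size B)%N -> uniq B ->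
  (forall a b c, a \in B -> b \in B -> c \in B -> a <> b -> b <> c -> a <> c -> det a b c <> 0) ->
  exists (A A' c : K) (b1 b2 : K * K) (s : seq (K * K)),
    [/\ perm_eq B [:: b1, b2 & s], 0 < A ^+ 2 + A' ^+ 2,
      A * b1.1 + A' * b1.2 + c = 0, A * b2.1 + A' * b2.2 + c = 0 &
      forall b, b \in s -> 0 < A * b.1 + A' * b.2 + c].
Proof.
move=> sz uB gp.
have [b1 b1B Hb1] := @exists_min_seq _ (fun x : K * K => x.1) B ltac:(by case: (B) sz).
suff [A [A' [c [b2 [b2B b12 [N f1 f2 Hf]]]]]] : exists A A' c (b2 : K * K), [/\ b2 \in B, b2 <> b1 &
    [/\ 0 < A ^+ 2 + A' ^+ 2, A * b1.1 + A' * b1.2 + c = 0, A * b2.1 + A' * b2.2 + c = 0 &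
      forall b, b \in B -> b <> b1 -> b <> b2 -> 0 < A * b.1 + A' * b.2 + c]].
  have b2B' : b2 \in rem b1 B by rewrite mem_rem_uniq // !inE b2B andbT; apply/eqP.
  exists A, A', c, b1, b2, (rem b2 (rem b1 B)); split => //.
    by rewrite (perm_trans (perm_to_rem b1B)) // perm_cons perm_to_rem.
  move=> b; rewrite mem_rem_uniq ?rem_uniq // !inE mem_rem_uniq // !inE.
  by move=> /andP[/eqP h2 /andP[/eqP h1 bB]]; apply: Hf.
have [[b2 [b2B b21 e]]|no] := pselect (exists b2, [/\ b2 \in B, b2 <> b1 & b2.1 = b1.1]).
  exists 1, 0, (- b1.1), b2; split => //; split.
  - by rewrite expr1n expr0n addr0.
  - by ring.
  - by rewrite e; ring.
  - move=> b bB bb1 bb2; have := Hb1 b bB; rewrite le_eqVlt => /orP[/eqP h|h]; last by lra.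
    exfalso; apply: (gp b1 b2 b) => //; try by move=> /esym.
    by rewrite /det e -h; ring.
have gt b : b \in B -> b <> b1 -> b1.1 < b.1.
  move=> bB bb1; rewrite lt_neqAle Hb1 // andbT; apply/eqP => e; apply: no.
  by exists b.
have nn : rem b1 B != [::].
  by rewrite -size_eq0 size_rem //; case: (size B) sz => [|[]].
have [b2 b2B' Hb2] := @exists_min_seq _ (fun x : K * K => (x.2 - b1.2) / (x.1 - b1.1)) _ nn.
move: (b2B'); rewrite mem_rem_uniq // !inE => /andP[/eqP b21 b2B].
pose sl := (b2.2 - b1.2) / (b2.1 - b1.1).
have n2 : b2.1 - b1.1 != 0 by apply: lt0r_neq0; have := gt b2 b2B b21; lra.
exists (- sl), 1, (sl * b1.1 - b1.2), b2; split => //; split.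
- by rewrite expr1n ltr_wpDl ?sqr_ge0.
- by ring.
- by rewrite /sl; field.
move=> b bB bb1 bb2.
have bB' : b \in rem b1 B by rewrite mem_rem_uniq // !inE bB andbT; apply/eqP.
have b0 : 0 < b.1 - b1.1 by have := gt b bB bb1; lra.
have := Hb2 b bB'; rewrite -/sl ler_pdivlMr // le_eqVlt => /orP[/eqP h|h]; last by lra.
exfalso; apply: (gp b1 b2 b) => //; try by move=> /esym.
rewrite /det -h /sl; by field.
Qed.

(** The rotation is there to make the levels of the points of [s] distinct. With [f] vanishing on
    the edge and [k] a coordinate along it that vanishes at [b1], take [h = f + e * k]: points with
    equal [f] differ in [k], and a small [e] does not close the gaps between different values of
    [f]. *)
Lemma slab B R : (1 < size B)%N -> uniq B ->
  (forall a b c, a \in B -> b \in B -> c \in B -> a <> b -> b <> c -> a <> c -> det a b c <> 0) ->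
  (forall a b r, a \in B -> b \in B -> r \in R -> a <> b -> det a b r <> 0) ->
  exists (A A' c d : K) (b1 b2 : K * K) (s : seq (K * K)),
    let h := fun x : K * K => A * x.1 + A' * x.2 + c in
    [/\ perm_eq B [:: b1, b2 & s], 0 < A ^+ 2 + A' ^+ 2, 0 < d,
      [/\ `|h b1| < d, `|h b2| < d, forall b, b \in s -> d < h b & forall r, r \in R -> d < `|h r|] &
      {in s &, injective h}].
Proof.
move=> sz uB gp gpR.
have [A [A' [c [b1 [b2 [s [pB N f1 f2 Hf]]]]]]] := hull_edge sz uB gp.
pose f (x : K * K) := A * x.1 + A' * x.2 + c.
pose k (x : K * K) := - A' * (x.1 - b1.1) + A * (x.2 - b1.2).
have memB x : (x \in B) = (x \in [:: b1, b2 & s]) by apply: perm_mem.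
have b1B : b1 \in B by rewrite memB inE eqxx.
have b2B : b2 \in B by rewrite memB !inE eqxx orbT.
have b12 : b1 <> b2.
  by move: uB; rewrite (perm_uniq pB) /= inE negb_or => /andP[/andP[/eqP h _] _].
have fk x y : f x = f y -> k x = k y -> x = y.
  rewrite /f /k => e1 e2.
  have E1 : (A ^+ 2 + A' ^+ 2) * (x.1 - y.1) = 0.
    have -> : (A ^+ 2 + A' ^+ 2) * (x.1 - y.1) = A * ((A * x.1 + A' * x.2 + c) - (A * y.1 + A' * y.2 + c))
       - A' * ((- A' * (x.1 - b1.1) + A * (x.2 - b1.2)) - (- A' * (y.1 - b1.1) + A * (y.2 - b1.2))) by ring.
    by rewrite e1 e2 !subrr !mulr0 subrr.
  have E2 : (A ^+ 2 + A' ^+ 2) * (x.2 - y.2) = 0.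
    have -> : (A ^+ 2 + A' ^+ 2) * (x.2 - y.2) = A' * ((A * x.1 + A' * x.2 + c) - (A * y.1 + A' * y.2 + c))
       + A * ((- A' * (x.1 - b1.1) + A * (x.2 - b1.2)) - (- A' * (y.1 - b1.1) + A * (y.2 - b1.2))) by ring.
    by rewrite e1 e2 !subrr !mulr0 addr0.
  rewrite [x]surjective_pairing [y]surjective_pairing.
  move/eqP: E1; move/eqP: E2; rewrite !mulf_eq0 !(gt_eqF N) /= !subr_eq0.
  by move=> /eqP -> /eqP ->.
have fR r : r \in R -> f r <> 0.
  move=> rR fr; apply: (gpR b1 b2 r) => //.
  have E a : (A ^+ 2 + A' ^+ 2) * a = 0 -> a = 0.
    by move/eqP; rewrite mulf_eq0 (gt_eqF N) /= => /eqP.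
  apply: E; rewrite /det; move: fr; rewrite /f => fr.
  (* The determinant written in the orthogonal directions [(A, A')] and [(- A', A)]: both [b2 - b1]
     and [r - b1] are orthogonal to [(A, A')], so each product vanishes. *)
  have -> : (A ^+ 2 + A' ^+ 2) * ((b2.1 - b1.1) * (r.2 - b1.2) - (b2.2 - b1.2) * (r.1 - b1.1)) =
    (A * (b2.1 - b1.1) + A' * (b2.2 - b1.2)) * (A * (r.2 - b1.2) - A' * (r.1 - b1.1)) +
    (A' * (b2.1 - b1.1) - A * (b2.2 - b1.2)) * (A' * (r.2 - b1.2) + A * (r.1 - b1.1)) by ring.
  have -> : A * (b2.1 - b1.1) + A' * (b2.2 - b1.2) = 0 by lra.
  have -> : A' * (r.2 - b1.2) + A * (r.1 - b1.1) = 0 by lra.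
  by rewrite mul0r mulr0 addr0.
(* The halves leave a margin [d] for the perturbation [e * k], kept below [d] in absolute value. *)
have : small (fun d => (forall b, b \in s -> d < f b / 2) /\ (forall r, r \in R -> d < `|f r| / 2)).
  apply: smallI; apply: small_all => x xs; apply: small_lt; apply: divr_gt0 => //.
    exact: Hf.
  by rewrite normr_gt0; apply/eqP; apply: fR.
move=> /small_ex[d d0 [ds dR]].
have : small (fun e => (forall x, x \in B ++ R -> e * k x < d /\ e * - k x < d) /\
    forall x, x \in s -> forall y, y \in s -> x <> y -> f x + e * k x <> f y + e * k y).
  apply: smallI.
    by apply: small_all => x _; apply: smallI; apply: small_mul_lt.
  apply: small_all => x xs; apply: small_all => y ys.
  have [->|/eqP xy] := eqVneq x y; first by exists 1.
  have [e|ne] := eqVneq (f x) (f y).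
    exists 1 => // e' /andP[e'0 _] _; rewrite e => /addrI /(mulfI (lt0r_neq0 e'0)).
    by move=> ke; apply: xy; apply: fk.
  have [lt|lt|e] := ltgtP (f x) (f y); last by rewrite e eqxx in ne.
    have : small (fun e => e * (k x - k y) < f y - f x) by apply: small_mul_lt; lra.
    by apply: smallW => e _ h _ E; lra.
  have : small (fun e => e * (k y - k x) < f x - f y) by apply: small_mul_lt; lra.
  by apply: smallW => e _ h _ E; lra.
move=> /small_ex[e e0 [eB es]].
exists (A - e * A'), (A' + e * A), (c + e * (A' * b1.1 - A * b1.2)), d, b1, b2, s => h.
have hE x : h x = f x + e * k x by rewrite /h /f /k; ring.
have kn x : x \in B ++ R -> `|e * k x| < d.
  by move=> /eB[h1 h2]; rewrite ltr_norml; apply/andP; split; lra.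
have f1' : f b1 = 0 by []. have f2' : f b2 = 0 by [].
split => //.
- have -> : (A - e * A') ^+ 2 + (A' + e * A) ^+ 2 = (1 + e ^+ 2) * (A ^+ 2 + A' ^+ 2) by ring.
  by apply: mulr_gt0 => //; rewrite ltr_wpDr ?sqr_ge0.
- split.
  + by rewrite hE f1' add0r; apply: kn; rewrite mem_cat b1B.
  + by rewrite hE f2' add0r; apply: kn; rewrite mem_cat b2B.
  + move=> b bs; rewrite hE; have := ds b bs; have bB : b \in B by rewrite memB !inE bs !orbT.
    have := kn b; rewrite mem_cat bB => /(_ isT); rewrite ltr_norml => /andP[h1 h2]; lra.
  + move=> r rR; rewrite hE; have := dR r rR.
    have := kn r; rewrite mem_cat rR orbT => /(_ isT).
    have := lerB_normD (f r) (e * k r); lra.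
- move=> x y xs ys; rewrite !hE => E; apply: contrapT => xy.
  exact: (es x xs y ys xy).
Qed.

Lemma separating_polygon B R j : size B = j.+1.*2 -> uniq B ->
  (forall a b c, a \in B -> b \in B -> c \in B -> a <> b -> b <> c -> a <> c -> det a b c <> 0) ->
  (forall a b r, a \in B -> b \in B -> r \in R -> a <> b -> det a b r <> 0) ->
  exists p C, [/\ good (3 * j.+1) p C,
    forall b, b \in B -> ninterior (3 * j.+1) p C b & forall r, r \in R -> ~ C r].
Proof.
move=> sz uB gp gpR.
have [|A [A' [c [d [b1 [b2 [s [pB N d0 [h1 h2 hs hR] hinj]]]]]]]] := slab _ uB gp gpR.
  by rewrite sz doubleS.
pose h (x : K * K) := A * x.1 + A' * x.2 + c.
have {}h1 : `|h b1| < d := h1.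
have {}h2 : `|h b2| < d := h2.
have {}hs b : b \in s -> d < h b := hs b.
have {}hR r : r \in R -> d < `|h r| := hR r.
have {}hinj : {in s &, injective h} := hinj.
have ah : affine h by exists A, A', c.
pose N2 := A ^+ 2 + A' ^+ 2; have N2n : N2 != 0 by apply: lt0r_neq0.
pose w (x : K * K) := - A' * x.1 + A * x.2.
have fr1 : frame w h (fun u v => ((A * (v - c) - A' * u) / N2, (A' * (v - c) + A * u) / N2)).
  split=> //.
  - by exists (- A'), A, 0 => x; rewrite /w addr0.
  - by move=> a b; rewrite /w /h /= /N2; split; field.
  - by move=> [x y]; rewrite /w /h /= /N2; congr pair; field.
  - by exists (- A * c / N2, - A' * c / N2), (- A' / N2, A / N2), (A / N2, A' / N2) => a b /=;
      congr pair; rewrite /N2; field.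
(* The point where the line through [u.1] and [u.2] crosses the level [h = 0]. *)
pose zp (u : (K * K) * (K * K)) : K * K := let S := (h u.2) / (h u.2 - h u.1) in
  (u.2.1 + S * (u.1.1 - u.2.1), u.2.2 + S * (u.1.2 - u.2.2)).
pose prs := [seq u <- [seq (x, y) | x <- s, y <- s] | h u.1 < h u.2].
have inprs x y : x \in s -> y \in s -> h x < h y -> (x, y) \in prs.
  move=> xs ys xy; rewrite mem_filter /= xy /=.
  by apply/allpairsP; exists (x, y).
pose pts := [:: b1; b2] ++ map zp prs.
have hpts x : x \in pts -> `|h x| < d.
  rewrite mem_cat => /orP[|/mapP[u]].
    by rewrite !inE => /orP[] /eqP ->.
  rewrite mem_filter => /andP[lt _] ->.
  rewrite /zp affine_segment // (_ : h u.2 + _ = 0) ?normr0 //.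
  by field; apply: lt0r_neq0; lra.
(* In the coordinates [(w, h)] the triangle has vertices [(- e^-1, - d)], [(e^-1, - d)] and
   [(0, d)]. These inequalities keep the points strictly between its two slanted sides. *)
have : small (fun e => forall x, x \in pts -> e * w x < (d - h x) / (d + d) /\ e * - w x < (d - h x) / (d + d)).
  apply: small_all => x /hpts; rewrite ltr_norml => /andP[x1 x2].
  by apply: smallI; apply: small_mul_lt; apply: divr_gt0; lra.
move=> /small_ex[e e0 He].
have D : (e^-1 + e^-1) * (d + d) - e^-1 * 0 != 0.
  have ei : 0 < e^-1 by rewrite invr_gt0.
  by rewrite mulr0 subr0; apply: lt0r_neq0; apply: mulr_gt0; lra.
have fr := frame_reparam (- e^-1) (- d) D fr1.
have [_ _ _ gK _] := fr.
set l := (fun x : K * K => ((w x - _) * _ - _) / _) in fr gK.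
set m := (fun x : K * K => (_ * (h x - _) - _) / _) in fr gK.
have en : e != 0 by apply: lt0r_neq0.
have dn : d + d != 0 by apply: lt0r_neq0; lra.
have mE x : m x = (h x + d) / (d + d).
  by rewrite /m; field; rewrite en dn.
have lE x : l x = (e * w x + 1 - m x) / 2.
  by rewrite mE /l; field; rewrite ?en ?dn.
have [p0 gd0 in0] := triangle_good fr.
clearbody l m.
have ptsin x : x \in pts -> ninterior 3 p0 [set x | in_triangle l m x] x.
  move=> xp; have [w1 w2] := He x xp; have := hpts x xp; rewrite ltr_norml => /andP[x1 x2].
  have E : (d - h x) / (d + d) = 1 - m x by rewrite mE; field; apply: lt0r_neq0; lra.
  have m0 : 0 < m x by rewrite mE; apply: divr_gt0; lra.
  by apply: in0 => //; rewrite lE; lra.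
have hC x : in_triangle l m x -> - d <= h x <= d.
  move=> [l0 m0 lm].
  have m1 : m x <= 1 by lra.
  by move: m0 m1; rewrite mE pmulr_lge0 ?invr_gt0 ?ler_pdivrMr; lra.
pose srt := sort (fun x y => h x <= h y) s.
have us : uniq s by move: uB; rewrite (perm_uniq pB) /= => /andP[_ /andP[]].
have ssrt x : (x \in srt) = (x \in s) by rewrite mem_sort.
have memB x : (x \in B) = (x \in [:: b1, b2 & s]) by apply: perm_mem.
have sB x : x \in s -> x \in B by move=> xs; rewrite memB !inE xs !orbT.
have strict (q : seq (K * K)) : {subset q <= s} -> uniq q -> pairwise (fun x y => h x <= h y) q ->
    pairwise (fun x y => h x < h y) q.
  elim: q => [//|a q IH] /= sub /andP[aq uq] /andP[hq pq]; apply/andP; split; last first.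
    by apply: IH => // x xq; apply: sub; rewrite inE xq orbT.
  apply/allP => x xq; rewrite lt_neqAle; move/allP: hq => -> //; rewrite andbT.
  apply: contra aq => /eqP /hinj -> //; first by apply: sub; rewrite inE eqxx.
  by apply: sub; rewrite inE xq orbT.
have [||||||p' [C' [gd' sub' b' R']]] := @attach_pairs h R ah j srt 3 p0 _ _ gd0.
- rewrite size_sort; have := perm_size pB; rewrite sz /= doubleS => -[] ->; by [].
- have : pairwise (fun x y => h x <= h y) srt.
    rewrite -sorted_pairwise; last by move=> y x z; apply: le_trans.
    by apply: sort_sorted => x y; apply: le_total.
  have : uniq srt by rewrite sort_uniq.
  have : {subset srt <= s} by move=> x; rewrite ssrt.
  exact: strict.
- move=> x b /hC /andP[_ hx]; rewrite ssrt => /hs; lra.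
- move=> b b'; rewrite !ssrt => bs b's bb'; exists ((h b') / (h b' - h b)) => //.
  have := ptsin (zp (b, b')); apply; rewrite mem_cat; apply/orP; right; apply: map_f.
  exact: inprs.
- move=> r rR /hC hr; have := hR r rR; rewrite ltNge ler_norml hr //.
- move=> b b' r; rewrite !ssrt => bs b's rR bb'; apply: gpR => //; [exact: sB|exact: sB|].
  by move=> E; rewrite E ltxx in bb'.
exists p', C'; rewrite mulnS; split => // b.
rewrite memB !inE => /orP[/eqP ->|/orP[/eqP ->|bs]].
- by apply: sub'; apply: ptsin; rewrite !inE eqxx.
- by apply: sub'; apply: ptsin; rewrite !inE eqxx orbT.
- by apply: b'; rewrite ssrt.
Qed.

Lemma small_quadratic (a b c : K) : ~ (a = 0 /\ b = 0) ->
  small (fun t => a * t ^+ 2 + b * t + c <> 0).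
Proof.
move=> ab; have [c0|c0] := eqVneq c 0.
  have [b0|b0] := eqVneq b 0.
    exists 1 => // t /andP[t0 _]; rewrite c0 b0 mul0r !addr0 => /eqP.
    by rewrite mulf_eq0 sqrf_eq0 (gt_eqF t0) orbF => /eqP a0; apply: ab.
  have : small (fun t => t * `|a| < `|b|) by apply: small_mul_lt; rewrite normr_gt0.
  apply: smallW => t t0 h e.
  have : (a * t + b) * t = 0 by rewrite -[RHS]e c0; ring.
  move/eqP; rewrite mulf_eq0 (gt_eqF t0) orbF => /eqP e'.
  have bE : b = - (a * t) by lra.
  by move: h; rewrite bE normrN normrM (gtr0_norm t0) mulrC ltxx.
have : small (fun t => t < 1 /\ t * (`|a| + `|b|) < `|c|).
  by apply: smallI; [apply: small_lt|apply: small_mul_lt; rewrite normr_gt0].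
apply: smallW => t t0 [t1 h] e.
have cE : c = - (t * (a * t + b)) by rewrite -[c]subr0 -e; ring.
move: h; rewrite {1}cE normrN normrM (gtr0_norm t0) ltNge ler_pM2l // => /negP; apply.
rewrite (le_trans (ler_normD _ _)) // lerD2r normrM (gtr0_norm t0) ler_piMr //; exact: ltW.
Qed.

(** A line meets the parabola of the points [(t, t ^+ 2)] at most twice, so a small [t > 0] avoids
    the finitely many lines spanned by [X]. *)
Lemma generic_point (X : seq (K * K)) : exists d : K * K,
  forall x y, x \in X -> y \in X -> x <> y -> det x y d <> 0.
Proof.
have : small (fun t => forall x, x \in X -> forall y, y \in X -> x <> y -> det x y (t, t ^+ 2) <> 0).
  apply: small_all => x _; apply: small_all => y _.
  have [->|/eqP xy] := eqVneq x y; first by exists 1.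
  have : ~ (y.1 - x.1 = 0 /\ - (y.2 - x.2) = 0).
    move=> [e1 e2]; apply: xy; rewrite [x]surjective_pairing [y]surjective_pairing.
    by congr pair; lra.
  move=> /(small_quadratic ((y.2 - x.2) * x.1 - (y.1 - x.1) * x.2)).
  by apply: smallW => t _ h _ e; apply: h; move: e; rewrite /det /=; lra.
by move=> /small_ex[t _ H]; exists (t, t ^+ 2) => x y xX yX; apply: H.
Qed.

Lemma card_eq_seq (X : set (K * K)) n : (X #= `I_n)%card ->
  exists s : seq (K * K), [/\ uniq s, size s = n & forall x, X x <-> x \in s].
Proof.
rewrite card_eq_sym => /card_set_bijP[f [f1 f2 f3]].
exists (map f (iota 0 n)); split; last 2 first.
- by rewrite size_map size_iota.
- move=> x; split=> [/f3[i /= ik <-]|/mapP[i]].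
    by apply: map_f; rewrite mem_iota.
  by rewrite mem_iota /= add0n => ik ->; apply: f1.
rewrite map_inj_in_uniq ?iota_uniq // => i j; rewrite !mem_iota /= !add0n => ik jk.
by apply: f2; rewrite inE.
Qed.

Theorem separating_polygon_upper n (B R : set (K * K)) : (1 <= n)%N -> bichromatic n B R ->
  exists (k : nat) (P : 'I_k -> K * K),
    [/\ (k <= 3 * uphalf n)%N, simple_polygon P & separates P B R].
Proof.
move=> n1 [/card_eq_seq[sB [uB szB memB]] /card_eq_seq[sR [uR szR memR]] dis gp].
have disj x y : x \in sB -> y \in sR -> x <> y.
  move=> /memB Bx /memR Ry e; have : (B `&` R) x by split => //; rewrite e.
  by rewrite dis.
have gp' x y z : x \in sB ++ sR -> y \in sB ++ sR -> z \in sB ++ sR ->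
    x <> y -> y <> z -> x <> z -> det x y z <> 0.
  have BR w : w \in sB ++ sR -> (B `|` R) w.
    by rewrite mem_cat => /orP[/memB|/memR]; [left|right].
  move=> /BR xX /BR yX /BR zX xy yz xz /(det_collinear xy).
  by apply: gp => //; apply/eqP.
have inB x : x \in sB -> x \in sB ++ sR by rewrite mem_cat => ->.
have inR x : x \in sR -> x \in sB ++ sR by rewrite mem_cat orbC => ->.
suff [sB' [j [sz uB' jn sub [gpB gpR]]]] : exists (sB' : seq (K * K)) j, [/\ size sB' = j.+1.*2,
    uniq sB', j.+1 = uphalf n, {subset sB <= sB'} &
    (forall a b c, a \in sB' -> b \in sB' -> c \in sB' ->
      a <> b -> b <> c -> a <> c -> det a b c <> 0) /\
    (forall a b r, a \in sB' -> b \in sB' -> r \in sR -> a <> b -> det a b r <> 0)].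
  have [p [C [gd inC outC]]] := separating_polygon sz uB' gpB gpR.
  have [sp ic ec] := good_polygon gd.
  exists (3 * j.+1)%N, (fun i => p i); split => //; first by rewrite jn.
  left; split=> x; first by move=> /memB /sub /inC; apply: ic.
  by move=> /memR /outC; apply: ec.
have [od|ev] := boolP (odd n); last first.
  have nE : n = (uphalf n).*2 by rewrite uphalf_half (negbTE ev) add0n even_halfK.
  have jE : (uphalf n).-1.+1 = uphalf n by lia.
  exists sB, (uphalf n).-1; rewrite jE -nE; split=> //; split.
    by move=> a b c aB bB cB; apply: gp'; apply: inB.
  move=> a b r aB bB rR ab; apply: gp' => //; try exact: inB; try exact: inR.
    exact: disj.
  exact: disj.
have [d Hd] := generic_point (sB ++ sR).
have detC x y z : det x y z = det y z x by rewrite /det; ring.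
(* If [d] were blue, it would be collinear with itself and any red point; a red point exists because
   [1 <= n]. *)
have dB : d \notin sB.
  apply/negP => dsB; have [r rR] : exists r, r \in sR.
    by case: (sR) szR => [/= e|r ? _]; [move: n1; rewrite -e|exists r; rewrite inE eqxx].
  apply: (Hd d r (inB _ dsB) (inR _ rR)); first exact: disj.
  by rewrite /det; ring.
exists (d :: sB), n./2; split.
- by rewrite /= szB doubleS; lia.
- by rewrite /= dB.
- by rewrite uphalf_half od.
- by move=> x xB; rewrite inE xB orbT.
split.
  move=> a b c; rewrite !inE => /orP[/eqP ->|aB] /orP[/eqP ->|bB] /orP[/eqP ->|cB] //.
  - by move=> _ bc _; rewrite detC; apply: Hd => //; apply: inB.
  - by move=> _ _ ac; rewrite -detC; apply: Hd; [exact: inB|exact: inB|move=> /esym].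
  - by move=> ab _ _; apply: Hd => //; apply: inB.
  - by apply: gp'; apply: inB.
move=> a b r; rewrite !inE => /orP[/eqP ->|aB] /orP[/eqP ->|bB] rR //.
- by move=> _; rewrite detC; apply: Hd; [exact: inB|exact: inR|exact: disj].
- by move=> _; rewrite -detC; apply: Hd; [exact: inR|exact: inB|move=> /esym; exact: disj].
- by move=> ab; apply: gp' => //; try exact: inB; try exact: inR; exact: disj.
Qed.

End Upper.

(** * The lower bound: alternating colours on a parabola *)

Section Lower.
Variable K : realType.

Lemma quadratic_three_roots (a b c t u v : K) : t <> u -> u <> v -> t <> v ->
  a * t + b * t ^+ 2 = c -> a * u + b * u ^+ 2 = c -> a * v + b * v ^+ 2 = c ->
  a = 0 /\ b = 0.
Proof.
move=> tu uv tv e1 e2 e3.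
have tu' : t - u != 0 by rewrite subr_eq0; apply/eqP.
have tv' : t - v != 0 by rewrite subr_eq0; apply/eqP.
have uv' : u - v != 0 by rewrite subr_eq0; apply/eqP.
have E1 : a + b * (t + u) = 0.
  apply: (mulfI tu'); rewrite mulr0.
  have -> : (t - u) * (a + b * (t + u)) = (a * t + b * t ^+ 2) - (a * u + b * u ^+ 2) by ring.
  by rewrite e1 e2 subrr.
have E2 : a + b * (t + v) = 0.
  apply: (mulfI tv'); rewrite mulr0.
  have -> : (t - v) * (a + b * (t + v)) = (a * t + b * t ^+ 2) - (a * v + b * v ^+ 2) by ring.
  by rewrite e1 e3 subrr.
have b0 : b = 0 by apply: (mulIf uv'); rewrite mul0r; lra.
by move: E1; rewrite b0 mul0r addr0.
Qed.

Definition parabola (i : nat) : K * K := (i%:R, i%:R ^+ 2).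

Lemma parabola_inj : injective parabola.
Proof. by move=> i j [/eqP]; rewrite eqr_nat => /eqP. Qed.

Lemma parabola_collinear i j k : i <> j -> j <> k -> i <> k ->
  ~ collinear (parabola i) (parabola j) (parabola k).
Proof.
move=> ij jk ik [a [b [c [ab [e1 e2 e3]]]]].
have ne m n : m <> n -> m%:R <> n%:R :> K by move=> mn /eqP; rewrite eqr_nat => /eqP.
have [a0 b0] := quadratic_three_roots (ne _ _ ij) (ne _ _ jk) (ne _ _ ik) e1 e2 e3.
by rewrite a0 b0 eqxx in ab.
Qed.

Lemma parabola_bichromatic n :
  bichromatic n [set parabola i.*2 | i in `I_n] [set parabola i.*2.+1 | i in `I_n].
Proof.
split.
- by apply: inj_card_eq => i j _ _ /parabola_inj /double_inj.
- by apply: inj_card_eq => i j _ _ /parabola_inj [] /double_inj.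
- apply/seteqP; split=> // x [[i _ <-] [j _ /parabola_inj]].
  by move/(congr1 odd); rewrite /= !odd_double.
have H x : ([set parabola i.*2 | i in `I_n] `|` [set parabola i.*2.+1 | i in `I_n]) x ->
    exists i, x = parabola i.
  by move=> [[i _ <-]|[i _ <-]]; eexists.
move=> p q r /H[i ->] /H[j ->] /H[k ->] ij jk ik; apply: parabola_collinear => e.
- by rewrite e eqxx in ij.
- by rewrite e eqxx in jk.
- by rewrite e eqxx in ik.
Qed.

(** A segment missing the boundary would put [x] and [y] into the same component, at once bounded
    and unbounded. *)
Lemma interior_exterior_segment k (P : 'I_k -> K * K) x y :
  polygon_interior P x -> polygon_exterior P y ->
  exists j, exists2 z, segment x y z & side P j z.
Proof.
move=> [nx bx] [ny uby]; apply: contrapT => no; apply: uby.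
have sub : segment x y `<=` ~` polygon_boundary P.
  by move=> z sz [j _ zj]; apply: no; exists j, z.
have cxy : connected_component (~` polygon_boundary P) x y.
  exact: (connected_component_max (segmentl x y) sub (@segment_connected2 _ _ _) (segmentr x y)).
by rewrite -(same_connected_component cxy).
Qed.

(* The trace of the line [a * x + b * y = c] on the parabola is quadratic. *)
Lemma edge_root (a b c t u : K) : t < u -> forall s, 0 < s < 1 ->
  (a * t + b * t ^+ 2 - c) + s * ((a * u + b * u ^+ 2 - c) - (a * t + b * t ^+ 2 - c)) = 0 ->
  exists2 r : K, t <= r < u & a * r + b * r ^+ 2 = c.
Proof.
move=> tu s /andP[s0 s1].
pose p : {poly K} := a *: 'X + b *: 'X^2 - c%:P.
have pE r : p.[r] = a * r + b * r ^+ 2 - c by rewrite /p !hornerE.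
rewrite -!pE => E.
have [pt0|pt0] := eqVneq p.[t] 0.
  by exists t; [rewrite lexx|move: pt0; rewrite pE; lra].
have [pu0|pu0] := eqVneq p.[u] 0.
  have : (1 - s) * p.[t] = 0 by rewrite pu0 in E; lra.
  by move/eqP; rewrite mulf_eq0 (negbTE pt0) orbF => /eqP; lra.
have [r /andP[tr ru] rr] : exists2 r, t <= r <= u & root p r.
  have [h|h] := ltP p.[t] 0.
    apply: poly_ivt; first exact: ltW.
    rewrite ltW //= leNgt; apply/negP => h'.
    have : 0 < s * - p.[u] by apply: mulr_gt0; lra.
    have : 0 < (1 - s) * - p.[t] by apply: mulr_gt0; lra.
    lra.
  have h0 : 0 < p.[t] by rewrite lt_neqAle eq_sym pt0.
  have [||r ru] := @poly_ivt _ (- p) t u; first exact: ltW.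
    rewrite !hornerN oppr_le0 (ltW h0) /= oppr_ge0 leNgt; apply/negP => h'.
    have : 0 < s * p.[u] by apply: mulr_gt0; lra.
    have : 0 < (1 - s) * p.[t] by apply: mulr_gt0; lra.
    lra.
  by rewrite rootN; exists r.
move/rootP: rr; rewrite pE => e.
exists r; last by lra.
rewrite tr lt_neqAle ru andbT; apply/eqP => er; move/eqP: pu0; apply.
by rewrite pE -er.
Qed.

(** Each edge that is met gives a root, in the half-open interval from its index to the next, of the
    quadratic of the line [P Q]. These intervals are disjoint, so three edges give three distinct
    roots; the coefficients then vanish, and [P = Q]. *)
Lemma side_meets_two_edges (P Q : K * K) (x1 x2 x3 : K * K) (N i j k : nat) : P <> Q ->
  (forall n, (n < N)%N -> ~ segment P Q (parabola n)) ->
  (i.+1 < N)%N -> (j.+1 < N)%N -> (k.+1 < N)%N -> i <> j -> j <> k -> i <> k ->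
  segment P Q x1 -> segment P Q x2 -> segment P Q x3 ->
  segment (parabola i) (parabola i.+1) x1 ->
  segment (parabola j) (parabola j.+1) x2 ->
  segment (parabola k) (parabola k.+1) x3 -> False.
Proof.
move=> PQ nv iN jN kN ij jk ik s1 s2 s3 e1 e2 e3.
pose a := - (Q.2 - P.2); pose b := Q.1 - P.1; pose c := a * P.1 + b * P.2.
have line x : segment P Q x -> a * x.1 + b * x.2 = c.
  by move=> /segmentP[t _ ->]; rewrite /c /a /b /=; ring.
have rt n x : (n.+1 < N)%N -> segment P Q x -> segment (parabola n) (parabola n.+1) x ->
    exists2 r : K, n%:R <= r < n.+1%:R & a * r + b * r ^+ 2 = c.
  move=> nN sx /segmentP[s /andP[s0 s1'] xE].
  apply: (@edge_root a b c n%:R n.+1%:R _ s); first by rewrite ltr_nat.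
    rewrite !lt_neqAle s0 s1' !andbT; apply/andP; split; apply/eqP => e.
      apply: (nv n); [lia|suff -> : parabola n = x by []].
      by rewrite xE -e /=; congr pair; ring.
    apply: (nv n.+1) => //; suff -> : parabola n.+1 = x by [].
    by rewrite xE e /=; congr pair; ring.
  by have := line x sx; rewrite xE /=; lra.
have [r1 h1 E1] := rt _ _ iN s1 e1; have [r2 h2 E2] := rt _ _ jN s2 e2; have [r3 h3 E3] := rt _ _ kN s3 e3.
have ne m n (r r' : K) : m <> n -> m%:R <= r < m.+1%:R -> n%:R <= r' < n.+1%:R -> r <> r'.
  move=> mn /andP[a1 a2] /andP[b1 b2] e; apply: mn; rewrite -e in b1 b2.
  have := le_lt_trans a1 b2; have := le_lt_trans b1 a2; rewrite !ltr_nat; lia.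
have [a0 b0] := quadratic_three_roots (ne _ _ _ _ ij h1 h2) (ne _ _ _ _ jk h2 h3) (ne _ _ _ _ ik h1 h3) E1 E2 E3.
apply: PQ; rewrite [P]surjective_pairing [Q]surjective_pairing.
by rewrite /a /b in a0 b0; congr pair; lra.
Qed.

Lemma card_le_double (A B : finType) (f : A -> B) :
  (forall x y z, x != y -> y != z -> x != z -> f x = f y -> f y = f z -> False) ->
  (#|A| <= #|B|.*2)%N.
Proof.
move=> H; have -> : #|A| = (\sum_(j : B) #|[pred x | f x == j]|)%N.
  rewrite -sum1_card (partition_big f predT) //=; apply: eq_bigr => j _.
  by rewrite -sum1_card.
rewrite -mul2n.
apply: (@leq_trans (\sum_(j : B) 2)%N); last by rewrite sum_nat_const mulnC.
apply: leq_sum => j _; rewrite leqNgt; apply/negP => /card_gt2P[x [y [z [[]]]]].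
rewrite !inE => /eqP xj /eqP yj /eqP zj [xy yz zx].
by apply: (H x y z) => //; [rewrite eq_sym|rewrite xj yj|rewrite yj zj].
Qed.

Theorem separating_polygon_lower n : exists B R : set (K * K),
  bichromatic n B R /\ forall (k : nat) (P : 'I_k -> K * K),
    (k < n)%N -> simple_polygon P -> ~ separates P B R.
Proof.
exists [set parabola i.*2 | i in `I_n], [set parabola i.*2.+1 | i in `I_n].
split; first exact: parabola_bichromatic.
move=> k P kn [k3 injP _ _] sep.
have colour i : (i < n.*2)%N -> [set parabola i.*2 | i in `I_n] (parabola i) /\ ~~ odd i \/
    [set parabola i.*2.+1 | i in `I_n] (parabola i) /\ odd i.
  move=> ik; have iE := odd_double_half i.
  case: (boolP (odd i)) iE => [od|ev] iE; [right|left]; split => //.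
    by exists i./2; [rewrite /=; lia|rewrite -[in RHS]iE].
  by exists i./2; [rewrite /=; lia|rewrite -[in RHS]iE].
have off i : (i < n.*2)%N -> ~ polygon_boundary P (parabola i).
  move=> ik; case: sep => -[h1 h2]; case: (colour i ik) => -[h _].
  - by have [] := h1 _ h.
  - by have [] := h2 _ h.
  - by have [] := h2 _ h.
  - by have [] := h1 _ h.
have hit (i : 'I_(n.*2.-1)) : exists j, exists2 z,
    segment (parabola i) (parabola i.+1) z & side P j z.
  have ik := ltn_ord i; have i1 : (i < n.*2)%N by lia.
  have i2 : (i.+1 < n.*2)%N by lia.
  have sym x y : (exists j, exists2 z, segment y x z & side P j z) ->
      exists j, exists2 z, segment x y z & side P j z by rewrite segmentC.
  case: sep => -[h1 h2]; case: (colour _ i1) => -[c1 o1]; case: (colour _ i2) => -[c2 o2];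
    try by rewrite /= ?o1 ?(negbTE o1) in o2.
  - exact: interior_exterior_segment (h1 _ c1) (h2 _ c2).
  - by apply: sym; exact: interior_exterior_segment (h1 _ c2) (h2 _ c1).
  - by apply: sym; exact: interior_exterior_segment (h1 _ c2) (h2 _ c1).
  - exact: interior_exterior_segment (h1 _ c1) (h2 _ c2).
have [f Hf] := choice hit.
have := card_le_double (f := f); rewrite !card_ord => H.
suff : (n.*2.-1 <= k.*2)%N by lia.
apply: H => x y z xy yz xz fxy fyz.
have [z1 e1 s1] := Hf x; have [z2 e2 s2] := Hf y; have [z3 e3 s3] := Hf z.
rewrite -fyz in s3; rewrite -fxy in s2 s3.
have ne (u v : 'I_(n.*2.-1)) : u != v -> nat_of_ord u <> v.
  by move=> uv e; move/eqP: uv; apply; apply/val_inj.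
have lt (u : 'I_(n.*2.-1)) : (u.+1 < n.*2)%N by have := ltn_ord u; lia.
apply: (@side_meets_two_edges _ _ _ _ _ n.*2 _ _ _ _ _ (lt x) (lt y) (lt z)
  (ne _ _ xy) (ne _ _ yz) (ne _ _ xz) s1 s2 s3 e1 e2 e3).
  move=> /injP /(congr1 val) /=; have fk := ltn_ord (f x).
  have [e|e] := eqVneq (f x).+1 k; first by rewrite e modnn; lia.
  by rewrite modn_small; lia.
by move=> m mn sm; apply: (off m mn); exists (f x).
Qed.

End Lower.

Theorem theorem11 (K : realType) :
  (forall (n : nat) (B R : set (K * K)),
     (1 <= n)%N -> bichromatic n B R ->
     exists (k : nat) (P : 'I_k -> K * K),
       [/\ (k <= 3 * uphalf n)%N, simple_polygon P & separates P B R])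
  /\
  (forall n : nat, (1 <= n)%N ->
     exists B R : set (K * K),
       bichromatic n B R /\
       forall (k : nat) (P : 'I_k -> K * K),
         (k < n)%N -> simple_polygon P -> ~ separates P B R).
Proof.
split; first exact: separating_polygon_upper.
by move=> n _; exact: separating_polygon_lower.
Qed.
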